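(* Let $\Lambda$ be an artin algebra and let $\Gamma \geq \Lambda$ be an excellent extension of $\Lambda$. Then: (i) $\Lambda$ satisfies the Auslander-Gorenstein Conjecture (AGC) if and only if $\Gamma$ satisfies AGC; (ii) $\Lambda$ satisfies the Nakayama Conjecture (NC) if and only if $\Gamma$ satisfies NC; (iii) $\Lambda$ satisfies the Gorenstein Symmetric Conjecture (GSC) if and only if $\Gamma$ satisfies GSC; (iv) $\Lambda$ satisfies the Finitistic Dimension Conjecture (FDC) if and only if $\Gamma$ satisfies FDC.
   Context: Excellent extensions. Let $\Lambda$ be a subring of a ring $\Gamma$ with the same identity; then $\Gamma$ is a ring extension of $\Lambda$, written $\Gamma\geq\Lambda$. It is a weak excellent extension if: (1) $\Gamma$ is right $\Lambda$-projective: whenever $N_\Gamma$ is a submodule of a right $\Gamma$-module $M_\Gamma$ and $N_\Lambda$ is a direct summand of $M_\Lambda$, then $N_\Gamma$ is a direct summand of $M_\Gamma$; (2) $\Gamma$ is a finite extension of $\Lambda$: there exist $\gamma_1,\ldots,\gamma_n\in\Gamma$ with $\Gamma=\sum_{i=1}^n\gamma_i\Lambda$; (3) $\Gamma_\Lambda$ is flat and ${}_\Lambda\Gamma$ is projective. It is an excellent extension if it is weak excellent and moreover $\Gamma_\Lambda$ and ${}_\Lambda\Gamma$ are free with a common basis $\gamma_1,\ldots,\gamma_n$ such that $\Lambda\gamma_i=\gamma_i\Lambda$ for all $1\leq i\leq n$. (It is a known fact that a weak excellent extension of an artin algebra is again an artin algebra.) Conventions. For an artin algebra $A$, $\mathrm{mod}\,A$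 is the category of finitely generated left $A$-modules; $\mathrm{pd}$ and $\mathrm{id}$ denote projective and injective dimension; ${}_AA$ and $A_A$ denote $A$ as a left and as a right module over itself. $A$ is Gorenstein if both $\mathrm{id}\,{}_AA$ and $\mathrm{id}\,A_A$ are finite. Conjectures as properties of an individual artin algebra $A$. Let $0\to A\to I^0\to I^1\to\cdots$ be a minimal injective resolution of the left $A$-module $A$. - $A$ satisfies AGC if: $\mathrm{pd}_A I^i\leq i$ for all $i\geq 0$ implies that $A$ is Gorenstein. - $A$ satisfies NC if: $I^i$ projective for all $i\geq 0$ implies that $A$ is self-injective. - $A$ satisfies GSC if $\mathrm{id}\,A_A=\mathrm{id}\,{}_AA$ (as elements of $\mathbb{N}\cup\{\infty\}$). - $A$ satisfies FDC if $\sup\{\mathrm{pd}_A M \mid M\in\mathrm{mod}\,A,\ \mathrm{pd}_A M<\infty\}<\infty$. *)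

(* Defs.v *)
From HB Require Import structures.
From mathcomp Require Import all_boot all_algebra.
From mathcomp Require Import boolp.

Set Implicit Arguments.
Unset Strict Implicit.
Unset Printing Implicit Defensive.

Import GRing.Theory.
Local Open Scope ring_scope.

(* Right A-modules are left modules over the converse ring: for M : rmodType A,
   a *: m stands for m a.  The right regular module A_A is (A^c)^o. *)
Notation rmodType A := (lmodType A^c).

Definition restr (L G : pzRingType) (f : {rmorphism L -> G}) (M : lmodType G) :
  Type := M.

Section Restriction.
Variables (L G : pzRingType) (f : {rmorphism L -> G}).

Section Lmod.
Variable M : lmodType G.
HB.instance Definition _ := GRing.Zmodule.on (restr f M).

Definition restr_scale (a : L) (m : restr f M) : restr f M := f a *: (m : M).

Fact restr_scaleA a b m : restr_scale a (restr_scale b m) = restr_scale (a * b) m.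
Proof. by rewrite /restr_scale rmorphM scalerA. Qed.
Fact restr_scale1 : left_id 1 restr_scale.
Proof. by move=> m; rewrite /restr_scale rmorph1 scale1r. Qed.
Fact restr_scaleDr : right_distributive restr_scale +%R.
Proof. by move=> a m n; rewrite /restr_scale scalerDr. Qed.
Fact restr_scaleDl m : {morph restr_scale^~ m : a b / a + b}.
Proof. by move=> a b; rewrite /restr_scale rmorphD scalerDl. Qed.
HB.instance Definition _ := GRing.Zmodule_isLmodule.Build L (restr f M)
  restr_scaleA restr_scale1 restr_scaleDr restr_scaleDl.
End Lmod.

Definition conv_morph : L^c -> G^c := f.
Fact conv_morph_zmod : zmod_morphism conv_morph.
Proof. exact: (rmorphB f). Qed.
Fact conv_morph_monoid : monoid_morphism conv_morph.
Proof. by split=> [|a b]; [exact: (rmorph1 f) | exact: (rmorphM f b a)]. Qed.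
HB.instance Definition _ :=
  GRing.isZmodMorphism.Build L^c G^c conv_morph conv_morph_zmod.
HB.instance Definition _ :=
  GRing.isMonoidMorphism.Build L^c G^c conv_morph conv_morph_monoid.
Definition conv_rmorphism : {rmorphism L^c -> G^c} := conv_morph.
End Restriction.

Section Modules.
Variable A : pzRingType.
Implicit Types M N X Y Z : lmodType A.

Definition surjective X Y (f : X -> Y) := forall y, exists x, f x = y.

Definition exact_pair X Y Z (f : X -> Y) (g : Y -> Z) :=
  forall y, g y = 0 <-> exists x, f x = y.

Definition generates M n (x : 'I_n -> M) :=
  forall m, exists a : 'I_n -> A, m = \sum_i a i *: x i.

Definition finitely_generated M := exists n (x : 'I_n -> M), generates x.

Definition lin_independent M n (x : 'I_n -> M) :=
  forall a : 'I_n -> A, \sum_i a i *: x i = 0 -> forall i, a i = 0.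

Definition basis M n (x : 'I_n -> M) := generates x /\ lin_independent x.

Definition direct_summand M (N : {pred M}) :=
  submod_closed N /\
  exists K : {pred M},
    [/\ submod_closed K,
        forall m, exists n k, [/\ n \in N, k \in K & m = n + k]
      & forall m, m \in N -> m \in K -> m = 0].

Definition artinian_module M :=
  forall N : nat -> {pred M},
    (forall k, submod_closed (N k)) ->
    (forall k, {subset N k.+1 <= N k}) ->
    exists n, forall k, (n <= k)%N -> N k =i N n.

Definition projective (P : lmodType A) :=
  forall X Y (g : {linear X -> Y}) (h : {linear P -> Y}),
    surjective g -> exists k : {linear P -> X}, forall p, g (k p) = h p.

Definition injective_module (I : lmodType A) :=
  forall X Y (f : {linear X -> Y}) (h : {linear X -> I}),
    injective f -> exists k : {linear Y -> I}, forall x, k (f x) = h x.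

Definition projective_resolution M (P : nat -> lmodType A)
    (d : forall i, {linear P i.+1 -> P i}) (e : {linear P 0 -> M}) :=
  [/\ forall i, projective (P i), surjective e,
      exact_pair (d 0) e
    & forall i, exact_pair (d i.+1) (d i)].

Definition injective_resolution M (I : nat -> lmodType A)
    (e : {linear M -> I 0}) (d : forall i, {linear I i -> I i.+1}) :=
  [/\ forall i, injective_module (I i), injective e,
      exact_pair e (d 0)
    & forall i, exact_pair (d i) (d i.+1)].

Definition essential_image X Y (f : X -> Y) :=
  forall K : {pred Y}, submod_closed K -> (exists2 y, y \in K & y != 0) ->
    exists2 x, f x \in K & f x != 0.

(* Each term is an injective envelope: I 0 of M (embedded by e), and I i.+1 of
   the image of d i, i.e. of the cokernel of the preceding map. *)
Definition minimal_injective_resolution M (I : nat -> lmodType A)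
    (e : {linear M -> I 0}) (d : forall i, {linear I i -> I i.+1}) :=
  [/\ injective_resolution e d, essential_image e
    & forall i, essential_image (d i)].

Definition zero_beyond (P : nat -> lmodType A) n :=
  forall i, (n < i)%N -> forall x : P i, x = 0.

(* The least natural number satisfying S, or None (infinity) if none does. *)
Definition least (S : nat -> Prop) : option nat :=
  if pselect (exists n, `[< S n >]) is left ex then Some (ex_minn ex) else None.

Definition dim_le (d : option nat) n := if d is Some k then (k <= n)%N else false.

Definition proj_dim M : option nat := least (fun n =>
  exists (P : nat -> lmodType A) (d : forall i, {linear P i.+1 -> P i})
         (e : {linear P 0 -> M}),
    projective_resolution d e /\ zero_beyond P n).

Definition inj_dim M : option nat := least (fun n =>
  exists (I : nat -> lmodType A) (e : {linear M -> I 0})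
         (d : forall i, {linear I i -> I i.+1}),
    injective_resolution e d /\ zero_beyond I n).

(* M tensor N over A is the free commutative monoid on M * N (finite sequences
   up to order) modulo the relations below; tensor_zero makes the quotient a group,
   with [:: (- x, y)] inverse to [:: (x, y)].  Elements are kept as
   representatives. *)
Inductive tensor_eq (M : rmodType A) (N : lmodType A) :
    seq (M * N) -> seq (M * N) -> Prop :=
| tensor_refl s : tensor_eq s s
| tensor_sym s t : tensor_eq s t -> tensor_eq t s
| tensor_trans s t u : tensor_eq s t -> tensor_eq t u -> tensor_eq s u
| tensor_cat s s' t t' :
    tensor_eq s s' -> tensor_eq t t' -> tensor_eq (s ++ t) (s' ++ t')
| tensor_comm s t : tensor_eq (s ++ t) (t ++ s)
| tensor_zero y : tensor_eq [:: (0, y)] [::]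
| tensor_addl x x' y : tensor_eq [:: (x + x', y)] [:: (x, y); (x', y)]
| tensor_addr x y y' : tensor_eq [:: (x, y + y')] [:: (x, y); (x, y')]
| tensor_bal (a : A) x y : tensor_eq [:: ((a : A^c) *: x, y)] [:: (x, a *: y)].

Definition tensor_map (M : rmodType A) X Y (f : X -> Y) (s : seq (M * X)) :
  seq (M * Y) := [seq (p.1, f p.2) | p <- s].

Definition flat (M : rmodType A) :=
  forall X Y (f : {linear X -> Y}), injective f ->
    forall s t : seq (M * X),
      tensor_eq (tensor_map f s) (tensor_map f t) -> tensor_eq s t.

End Modules.

Section RingProperties.
Variable A : pzRingType.

Definition artin_algebra :=
  exists (R : comPzRingType) (phi : {rmorphism R -> A}),
    [/\ artinian_module (R^o : lmodType R),
        forall r a, phi r * a = a * phi r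
      & finitely_generated (restr phi A^o : lmodType R)].

Definition left_regular : lmodType A := A^o.
Definition right_regular : rmodType A := (A^c)^o.

Definition Gorenstein :=
  inj_dim left_regular <> None /\ inj_dim right_regular <> None.

Definition self_injective := injective_module left_regular.

Definition AGC :=
  forall (I : nat -> lmodType A) (e : {linear left_regular -> I 0})
         (d : forall i, {linear I i -> I i.+1}),
    minimal_injective_resolution e d ->
    (forall i, dim_le (proj_dim (I i)) i) -> Gorenstein.

Definition NC :=
  forall (I : nat -> lmodType A) (e : {linear left_regular -> I 0})
         (d : forall i, {linear I i -> I i.+1}),
    minimal_injective_resolution e d ->
    (forall i, projective (I i)) -> self_injective.

Definition GSC := inj_dim right_regular = inj_dim left_regular.

Definition FDC :=
  exists b : nat, forall M : lmodType A,
    finitely_generated M -> proj_dim M <> None -> dim_le (proj_dim M) b.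

End RingProperties.

(* A ring extension G of L is given by an injective ring morphism f : L -> G. *)
Section Extensions.
Variables (L G : pzRingType) (f : {rmorphism L -> G}).

Definition left_ext : lmodType L := restr f (left_regular G).
Definition right_ext : rmodType L := restr (conv_rmorphism f) (right_regular G).

Definition right_relatively_projective :=
  forall (M : rmodType G) (N : {pred M}), submod_closed N ->
    direct_summand (N : {pred restr (conv_rmorphism f) M}) -> direct_summand N.

Definition finite_extension :=
  exists n (g : 'I_n -> right_ext), generates g.

Definition weak_excellent_extension :=
  [/\ injective f, right_relatively_projective, finite_extension,
      flat right_ext & projective left_ext].

Definition excellent_extension :=
  weak_excellent_extension /\
  exists n (g : 'I_n -> G),
    [/\ basis (g : 'I_n -> right_ext), basis (g : 'I_n -> left_ext)
      & forall i x, (exists a, x = f a * g i) <-> (exists b, x = g i * f b)].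

End Extensions.

(* Main.v *)
Require Import Defs.
From HB Require Import structures.
From mathcomp Require Import all_boot all_order all_algebra.
From mathcomp Require Import boolp classical_sets.

Set Implicit Arguments.
Unset Strict Implicit.
Unset Printing Implicit Defensive.

Import Order.TTheory GRing.Theory Num.Theory.
Local Open Scope ring_scope.

(* Let g_1, ..., g_n be the common basis and a g_i = g_i sigma_i(a), where sigma_i is an
   automorphism of L = Lambda; write G = Gamma.  Over L, the induced module G (x)_L M is
   the direct sum of the twists of M by the sigma_i, so induction preserves and reflects
   projective dimension, and it preserves essential extensions.  Restriction preserves
   projectives and injectives, being adjoint on either side to an exact functor.

   The remaining point is that a left G-module which is injective over L is injective over
   G, and that every finitely generated left G-module is a retract of an induced one.  The
   hypothesis only concerns right modules.  Applied to the character modules Hom(-, Q/Z),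
   it shows that an L-split inclusion of left G-modules is pure; since G is left
   noetherian, purity suffices, by Baer's criterion in the first case and by finite
   presentation in the second.

   Hence inducing a minimal injective resolution of L gives one of G.  Conversely L is a
   retract of G over L, and a minimal injective resolution of L is carved out, summand by
   summand, of the restriction of an injective resolution of G. *)

(** The difficulty is a mismatch of sides. The splitting condition is about right modules, so for
    right modules it gives relative injectivity at once: a module embeds in its coinduced module,
    and evaluation at 1 splits the embedding over Lambda. But AGC, NC and FDC are about left
    modules, and dualising to reach them has a price: characters only control finite systems of
    linear equations. This is where the artin hypothesis enters. A commutative artinian ring is
    noetherian, so Gamma is left noetherian and finite systems are enough.

    AGC and NC are implications quantified over minimal injective resolutions. Each direction
    therefore turns a given resolution over one ring into some resolution over the other, together
    with the conditions on its terms. Dimensions are compared through retracts: the bounds [pd_le]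
    and [id_le] pass to retracts, and every comparison of modules over the two rings is brought to
    that form. AGC and GSC involve the right regular module too; the basis condition is symmetric,
    so the same lemmas are applied to the converse rings. *)

Definition make_linear (A : pzRingType) (X Y : lmodType A) (h : X -> Y)
    (hlin : forall a x y, h (a *: x + y) = a *: h x + h y) : {linear X -> Y} :=
  HB.pack h (GRing.isLinear.Build A X Y *:%R h hlin).

(** * Submodules and retracts *)

Section Submodules.
Variable A : pzRingType.
Implicit Types I M N X Y Z : lmodType A.

(** [Prop]-valued, so that kernels, images and sums are given by their defining formulas;
    [submod_closedP] and [submodule_pred] convert from and to the boolean form. *)
Definition submodule M (S : M -> Prop) :=
  S 0 /\ forall a x y, S x -> S y -> S (a *: x + y).

Section Closure.
Variables (M : lmodType A) (S : M -> Prop) (Ssub : submodule S).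

Lemma submod0 : S 0. Proof. by case: Ssub. Qed.
Lemma submodP a x y : S x -> S y -> S (a *: x + y).
Proof. by case: Ssub => _; apply. Qed.
Lemma submodD x y : S x -> S y -> S (x + y).
Proof. by move=> Sx Sy; rewrite -[x]scale1r; exact: submodP. Qed.
Lemma submodZ a x : S x -> S (a *: x).
Proof. by move=> Sx; rewrite -[_ *: _]addr0; apply: submodP => //; exact: submod0. Qed.
Lemma submodB x y : S x -> S y -> S (x - y).
Proof. by move=> Sx Sy; rewrite -scaleN1r addrC; exact: submodP. Qed.
Lemma submod_sum (T : Type) (r : seq T) (P : pred T) (F : T -> M) :
  (forall i, P i -> S (F i)) -> S (\sum_(i <- r | P i) F i).
Proof. by move=> SF; elim/big_ind: _ => //; [exact: submod0 | exact: submodD]. Qed.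
End Closure.

Lemma submod_closedP M (K : {pred M}) : submod_closed K -> submodule (fun x => x \in K).
Proof. by case=> K0 KP; split=> // a x y Kx Ky; apply: KP. Qed.

Lemma submodule_pred M (S : M -> Prop) :
  submodule S -> submod_closed (fun x => `[< S x >]).
Proof.
case=> S0 SP; split=> [|a x y]; first exact: asboolT.
by move=> /asboolW Sx /asboolW Sy; apply/asboolT/SP.
Qed.

Record submod M (S : M -> Prop) (Ssub : submodule S) :=
  Submod { submod_val : M; submod_valP : S submod_val }.

Section SubmodLmod.
Variables (M : lmodType A) (S : M -> Prop) (Ssub : submodule S).
Notation U := (submod Ssub).

HB.instance Definition _ := gen_eqMixin U.
HB.instance Definition _ := gen_choiceMixin U.

Lemma submod_val_inj : injective (@submod_val M S Ssub).
Proof. by case=> x Sx [y Sy] /= xy; subst y; congr Submod; apply: Prop_irrelevance. Qed.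

Let add (x y : U) : U := Submod Ssub (submodD Ssub (submod_valP x) (submod_valP y)).
Let opp (x : U) : U := Submod Ssub (eq_ind _ S (submodZ Ssub (-1) (submod_valP x)) _ (scaleN1r _)).
Let zero : U := Submod Ssub (submod0 Ssub).
Let scale a (x : U) : U := Submod Ssub (submodZ Ssub a (submod_valP x)).

Let addA : associative add.
Proof. by move=> x y z; apply/submod_val_inj/addrA. Qed.
Let addC : commutative add.
Proof. by move=> x y; apply/submod_val_inj/addrC. Qed.
Let add0 : left_id zero add.
Proof. by move=> x; apply/submod_val_inj/add0r. Qed.
Let addN : left_inverse zero opp add.
Proof. by move=> x; apply/submod_val_inj/addNr. Qed.
HB.instance Definition _ := GRing.isZmodule.Build U addA addC add0 addN.

Let scaleA a b x : scale a (scale b x) = scale (a * b) x.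
Proof. exact/submod_val_inj/scalerA. Qed.
Let scale1 : left_id 1 scale.
Proof. by move=> x; apply/submod_val_inj/scale1r. Qed.
Let scaleDr : right_distributive scale +%R.
Proof. by move=> a x y; apply/submod_val_inj/scalerDr. Qed.
Let scaleDl x : {morph scale^~ x : a b / a + b}.
Proof. by move=> a b; apply/submod_val_inj/scalerDl. Qed.
HB.instance Definition _ := GRing.Zmodule_isLmodule.Build A U scaleA scale1 scaleDr scaleDl.

Definition submod_incl : {linear U -> M} :=
  make_linear (h := @submod_val M S Ssub) (fun a x y => erefl).

Lemma submod_incl_inj : injective submod_incl.
Proof. exact: submod_val_inj. Qed.
End SubmodLmod.

Lemma linear_corestrict X M (S : M -> Prop) (Ssub : submodule S) (h : {linear X -> M}) :
  (forall x, S (h x)) -> {k : {linear X -> submod Ssub} | forall x, submod_incl Ssub (k x) = h x}.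
Proof.
move=> Sh; have klin a x y : Submod Ssub (Sh (a *: x + y)) =
    a *: Submod Ssub (Sh x) + Submod Ssub (Sh y).
  by apply/submod_val_inj; rewrite /= linearP.
by exists (make_linear klin).
Qed.

Lemma submod_set0 M : submodule (fun x : M => x = 0).
Proof. by split=> // a x y -> ->; rewrite scaler0 addr0. Qed.

Lemma submod_ker X Y (h : {linear X -> Y}) : submodule (fun x => h x = 0).
Proof. by split=> [|a x y hx hy]; rewrite ?linear0 // linearP hx hy scaler0 addr0. Qed.

Lemma submod_im X Y (h : {linear X -> Y}) : submodule (fun y => exists x, h x = y).
Proof.
split=> [|a x y [u <-] [v <-]]; first by exists 0; rewrite linear0.
by exists (a *: u + v); rewrite linearP.
Qed.

Lemma submod_add M (S T : M -> Prop) : submodule S -> submodule T ->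
  submodule (fun z => exists x y, [/\ S x, T y & z = x + y]).
Proof.
move=> Ss Ts; split=> [|a z w [x [y [Sx Ty ->]]] [x' [y' [Sx' Ty' ->]]]].
  by exists 0, 0; rewrite addr0; split=> //; [exact: submod0 Ss | exact: submod0 Ts].
exists (a *: x + x'), (a *: y + y'); split; [by apply: (submodP Ss)|by apply: (submodP Ts)|].
by rewrite scalerDr addrACA.
Qed.

Lemma submod_image X Y (h : {linear X -> Y}) (S : X -> Prop) :
  submodule S -> submodule (fun y => exists2 x, S x & h x = y).
Proof.
move=> Ss; split=> [|a _ _ [u Su <-] [v Sv <-]].
  by exists 0; rewrite ?linear0 //; exact: submod0 Ss.
by exists (a *: u + v); rewrite ?linearP //; by apply: (submodP Ss).
Qed.

Lemma submod_cyclic M (x : M) : submodule (fun y => exists a, y = a *: x).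
Proof.
split=> [|a _ _ [b ->] [c ->]]; first by exists 0; rewrite scale0r.
by exists (a * b + c); rewrite scalerDl scalerA.
Qed.

(** Since [p] is a condition on single elements, it passes to unions of chains, and Zorn's lemma
    applies. Single-valuedness, essentiality and trivial intersection are all expressed below by
    such a [p]. *)
Lemma maximal_submodule M (p K0 : M -> Prop) : submodule K0 -> (forall x, K0 x -> p x) ->
  exists K : M -> Prop, [/\ submodule K, forall x, K0 x -> K x, forall x, K x -> p x
    & forall K' : M -> Prop, submodule K' -> (forall x, K x -> K' x) ->
        (forall x, K' x -> p x) -> forall x, K' x -> K x].
Proof.
move=> K0s K0p.
pose good (K : M -> Prop) :=
  [/\ submodule K, forall x, K0 x -> K x & forall x, K x -> p x].
pose T := {K | good K}.
pose le (K L : T) := `[< forall x, sval K x -> sval L x >].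
have t0 : T by exists K0.
have [t|r s t /asboolP rs /asboolP st|C Ctot|[K [Ks K0K Kp]] Kmax] := @ZL_preorder T t0 le.
- exact/asboolP.
- by apply/asboolP => x /rs /st.
- have [[c0 Cc0]|noC] := pselect (exists c, C c); last first.
    by exists t0 => s Cs; case: noC; exists s.
  have Us : submodule (fun x => exists2 c, C c & sval c x).
    split=> [|a x y [c Cc cx] [d Cd dy]].
      by exists c0 => //; have [] := svalP c0 => -[].
    have [/asboolP cd|/asboolP dc] := Ctot _ _ Cc Cd.
      by exists d => //; have [[_ +] _ _] := svalP d; apply=> //; apply: cd.
    by exists c => //; have [[_ +] _ _] := svalP c; apply=> //; apply: dc.
  have Up : good (fun x => exists2 c, C c & sval c x).
    split=> // x; first by move=> K0x; exists c0 => //; have [_ + _] := svalP c0; apply.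
    by case=> c _ cx; have [_ _] := svalP c; apply.
  by exists (exist good _ Up) => c Cc; apply/asboolP => x cx; exists c.
- exists K; split=> // K' K's KK' K'p x K'x.
  have K'P : good K' by split=> // y /K0K /KK'.
  have /asboolP := Kmax (exist good _ K'P) (asboolT KK'); exact.
Qed.

Lemma linear_factor X Y Z (p : {linear X -> Y}) (t : {linear X -> Z}) :
  surjective p -> (forall x, p x = 0 -> t x = 0) ->
  exists k : {linear Y -> Z}, forall x, k (p x) = t x.
Proof.
move=> psurj ker; have [s sK] := choice psurj.
have st x : t (s (p x)) = t x.
  by apply/subr0_eq; rewrite -linearB; apply: ker; rewrite linearB sK subrr.
have klin a x y : t (s (a *: x + y)) = a *: t (s x) + t (s y).
  by rewrite -linearP -[RHS]st linearP /= !sK.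
by exists (make_linear klin).
Qed.

Lemma linear_cofactor X Y Z (i : {linear X -> Y}) (t : {linear Z -> Y}) :
  injective i -> (forall z, exists x, i x = t z) ->
  exists k : {linear Z -> X}, forall z, i (k z) = t z.
Proof.
move=> iinj /choice[s sK].
have klin a x y : s (a *: x + y) = a *: s x + s y.
  by apply: iinj; rewrite linearP !sK linearP.
by exists (make_linear klin).
Qed.

Lemma linear_injP X Y (h : {linear X -> Y}) : (forall x, h x = 0 -> x = 0) -> injective h.
Proof. by move=> h0 x y hxy; apply/subr0_eq/h0; rewrite linearB /= hxy subrr. Qed.

Lemma linear_inj0 X Y (h : {linear X -> Y}) x : injective h -> h x = 0 -> x = 0.
Proof. by move=> hinj hx; apply: hinj; rewrite hx linear0. Qed.

Lemma complement_linear_proof X (h : {linear X -> X}) a x y :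
  (a *: x + y) - h (a *: x + y) = a *: (x - h x) + (y - h y).
Proof. by rewrite [h _]linearP opprD addrACA scalerBr. Qed.
Definition complement_linear X (h : {linear X -> X}) : {linear X -> X} :=
  make_linear (complement_linear_proof h).

Definition retract M X := exists (s : {linear M -> X}) (r : {linear X -> M}), forall m, r (s m) = m.

Lemma retract_projective M X : retract M X -> projective X -> projective M.
Proof.
case=> s [r rs] projX Y Z g h gsurj.
have [k kP] := projX Y Z g (h \o r : {linear X -> Z}) gsurj.
by exists (k \o s : {linear M -> Y}) => m /=; rewrite kP /= rs.
Qed.

Lemma retract_injective M X : retract M X -> injective_module X -> injective_module M.
Proof.
case=> s [r rs] injX Y Z g h ginj.
have [k kP] := injX Y Z g (s \o h : {linear Y -> X}) ginj.
by exists (r \o k : {linear Z -> M}) => y /=; rewrite kP /= rs.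
Qed.

Lemma pair_projective M N : projective M -> projective N -> projective (M * N)%type.
Proof.
move=> projM projN X Y g h gsurj.
have hMlin a (x y : M) : h (a *: x + y, 0) = a *: h (x, 0) + h (y, 0).
  by rewrite -linearP; congr (h (_, _)); rewrite /= scaler0 addr0.
have hNlin a (x y : N) : h (0, a *: x + y) = a *: h (0, x) + h (0, y).
  by rewrite -linearP; congr (h (_, _)); rewrite /= scaler0 addr0.
have [k kP] := projM X Y g (make_linear hMlin) gsurj.
have [l lP] := projN X Y g (make_linear hNlin) gsurj.
have klin a (x y : M * N) : k (a *: x + y).1 + l (a *: x + y).2
    = a *: (k x.1 + l x.2) + (k y.1 + l y.2).
  by rewrite /= !linearP scalerDr addrACA.
by exists (make_linear klin) => -[m n] /=;
rewrite linearD kP lP /= -linearD; congr (h (_, _)); rewrite /= ?addr0 ?add0r.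
Qed.

Lemma pair_injective M N : injective_module M -> injective_module N -> injective_module (M * N)%type.
Proof.
move=> injM injN X Y f h finj.
have h1lin a x y : (h (a *: x + y)).1 = a *: (h x).1 + (h y).1 by rewrite linearP.
have h2lin a x y : (h (a *: x + y)).2 = a *: (h x).2 + (h y).2 by rewrite linearP.
have [k kP] := injM X Y f (make_linear h1lin) finj.
have [l lP] := injN X Y f (make_linear h2lin) finj.
have klin a x y : (k (a *: x + y), l (a *: x + y)) = a *: (k x, l x) + (k y, l y).
  by congr pair; rewrite linearP.
by exists (make_linear klin) => x /=; rewrite kP lP /=; case: (h x).
Qed.

(** A partial homomorphism from [Y] to [I] is given by its graph [H]. The condition at 0 makes the
    first projection of [H] injective, and the second projection is extended along it. *)
Lemma injective_graph I Y (H : (Y * I)%type -> Prop) :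
  injective_module I -> submodule H -> (forall j, H (0, j) -> j = 0) ->
  exists k : {linear Y -> I}, forall y j, H (y, j) -> k y = j.
Proof.
move=> injI Hs H0.
have fstlin a (x y : submod Hs) : (submod_incl Hs (a *: x + y)).1 =
   a *: (submod_incl Hs x).1 + (submod_incl Hs y).1 by rewrite linearP.
have sndlin a (x y : submod Hs) : (submod_incl Hs (a *: x + y)).2 =
   a *: (submod_incl Hs x).2 + (submod_incl Hs y).2 by rewrite linearP.
have [|k kP] := injI _ _ (make_linear fstlin) (make_linear sndlin).
  apply: linear_injP => -[[y j] Hyj] /= y0; apply: submod_val_inj => /=.
  by move: Hyj; rewrite y0 => /H0->.
by exists k => y j Hyj; apply: kP (Submod Hs Hyj).
Qed.

(** Baer's condition, with a left ideal and a homomorphism on it encoded together as a graph. *)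
Definition baer I := forall H : (A^o * I)%type -> Prop, submodule H ->
  (forall j, H (0, j) -> j = 0) -> exists i : I, forall (a : A) j, H (a, j) -> a *: i = j.

Lemma baer_injective I : baer I -> injective_module I.
Proof.
move=> baerI X Y f h finj.
pose G0 (z : (Y * I)%type) := exists x, z = (f x, h x).
have G0s : submodule G0.
  split=> [|a _ _ [x ->] [y ->]]; first by exists 0; rewrite !linear0.
  by exists (a *: x + y); rewrite !linearP.
(* The elementwise condition says that a relation is single-valued. A maximal one is the graph of a
   partial extension of [h]; it remains to see that it is defined everywhere. *)
have [|G [Gs G0G G0' Gmax]] := @maximal_submodule _ (fun z : (Y * I)%type => z.1 = 0 -> z.2 = 0) _ G0s.
  by move=> _ [x ->] /= fx0; rewrite (finj x 0) ?linear0.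
have Guniq y i j : G (y, i) -> G (y, j) -> i = j.
  move=> Gi Gj; apply/subr0_eq; apply: (G0' _ (submodB Gs Gi Gj)) => /=.
  by rewrite subrr.
have tot y : exists i, G (y, i).
  (* The graph of the map that [G] induces on the left ideal of all [a] with [a *: y] in its domain.
     The element supplied by Baer's condition is then a consistent value at [y]. *)
  pose H (z : (A^o * I)%type) := G ((z.1 : A) *: y, z.2).
  have Hs : submodule H.
    split=> [|a u v Hu Hv]; rewrite /H /=; first by rewrite scale0r; apply: submod0 Gs.
    rewrite scalerDl -scalerA; exact: (submodP Gs a Hu Hv).
  have [|i iP] := baerI H Hs.
    by move=> j; rewrite /H /= scale0r => /G0'; apply.
  exists i.
  pose G' (z : (Y * I)%type) := exists u v, [/\ G u, exists a : A, v = a *: ((y, i) : (Y * I)%type) & z = u + v].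
  apply: (Gmax G').
  - exact: submod_add Gs (submod_cyclic _).
  - by move=> x Gx; exists x, 0; rewrite addr0; split=> //; exists 0; rewrite scale0r.
  - move=> _ [[u1 u2] [_ [Gu [a ->] ->]]] /= /eqP; rewrite addr_eq0 => /eqP u1E.
    have : H (- a, u2) by rewrite /H /= scaleNr -u1E.
    by move=> /iP <-; rewrite scaleNr addNr.
  - exists 0, (y, i); rewrite add0r; split=> //; first exact: submod0 Gs.
    by exists 1; rewrite scale1r.
have [k kP] := choice tot.
have klin a x y : k (a *: x + y) = a *: k x + k y.
  apply: Guniq (kP _) _; exact: (submodP Gs a (kP x) (kP y)).
exists (make_linear klin) => x /=; apply: Guniq (kP _) _; apply: G0G; by exists x.
Qed.

End Submodules.

(** * Projective and injective dimension *)

Section Dimensions.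
Variable A : pzRingType.
Implicit Types C I K M N P X Y Z : lmodType A.

(** The dimension bound is obtained by peeling off one short exact sequence at a time, with any
    suitable syzygy; this form fits the inductions below. [id_le] is the dual. *)
Fixpoint pd_le n M : Prop :=
  if n is n'.+1 then
    exists P K (i : {linear K -> P}) (p : {linear P -> M}),
      [/\ projective P, injective i, exact_pair i p, surjective p & pd_le n' K]
  else projective M.

Fixpoint id_le n M : Prop :=
  if n is n'.+1 then
    exists I C (j : {linear M -> I}) (p : {linear I -> C}),
      [/\ injective_module I, injective j, exact_pair j p, surjective p & id_le n' C]
  else injective_module M.

Definition zero_module : lmodType A := submod (submod_set0 A^o).

Lemma zero_moduleP (x : zero_module) : x = 0.
Proof. exact/submod_val_inj/(submod_valP x). Qed.

Lemma zero_linear_proof X Y (a : A) (x y : X) : (0 : Y) = a *: 0 + 0.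
Proof. by rewrite scaler0 addr0. Qed.
Definition zero_linear X Y : {linear X -> Y} := make_linear (@zero_linear_proof X Y).

Lemma zero_module_projective : projective zero_module.
Proof.
move=> X Y g h _; exists (zero_linear _ _) => p /=.
by rewrite (zero_moduleP p) !linear0.
Qed.

Lemma zero_module_injective : injective_module zero_module.
Proof.
move=> X Y g h _; exists (zero_linear _ _) => p /=.
by rewrite [RHS]zero_moduleP.
Qed.

Definition cons_module M (P : nat -> lmodType A) i : lmodType A :=
  if i is j.+1 then P j else M.

Lemma proj_res_pd_le n M : (exists (P : nat -> lmodType A) (d : forall i, {linear P i.+1 -> P i})
    (e : {linear P 0 -> M}), projective_resolution d e /\ zero_beyond P n) <-> pd_le n M.
Proof.
elim: n M => [|n IHn] M; split.
- move=> [P [d [e [[projP esurj ex0 _] P0]]]]; apply: (@retract_projective _ _ (P 0)) => //.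
  have [|k kP] := linear_cofactor (i := e) (t := idfun) _ esurj; last by exists k, e.
  by apply: linear_injP => x /ex0[y <-]; rewrite (P0 1%N isT y) linear0.
- move=> projM; exists (cons_module M (fun=> zero_module)).
  exists (fun i => zero_linear _ _), idfun; split; [split|].
  + by case=> // k; exact: zero_module_projective.
  + by move=> y; exists y.
  + move=> y; split=> [/= ->|[x <-]]; last by rewrite (zero_moduleP x) linear0.
    by exists 0.
  + move=> i y; split=> [_|_].
      by exists 0; rewrite [RHS]zero_moduleP.
    by rewrite (zero_moduleP y) linear0.
  + by case=> // i _ x; exact: zero_moduleP.
- move=> [P [d [e [[projP esurj ex0 exS] P0]]]].
  have [d0 d0P] := linear_corestrict (submod_ker e) (h := d 0) (fun x => (ex0 _).2 (ex_intro _ x erefl)).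
  exists (P 0), (submod (submod_ker e)), (submod_incl _), e; split=> //.
  + exact: submod_incl_inj.
  + move=> y; split=> [y0|[x <-]]; last exact: submod_valP x.
    by exists (Submod (submod_ker e) y0).
  apply/IHn; exists (fun i => P i.+1), (fun i => d i.+1), d0; split; last by move=> i ni; apply: P0.
  split=> //.
  + case=> y y0; have [x xy] := (ex0 y).1 y0; exists x.
    by apply/submod_val_inj; rewrite /= -xy; exact: d0P.
  + move=> y; rewrite -exS; split=> [y0|y0]; first by rewrite -d0P y0 linear0.
    by apply: (@submod_incl_inj _ _ _ (submod_ker e)); rewrite d0P y0 linear0.
- move=> [P [K [i [p [projP iinj ex psurj /IHn[Q [d [e [[projQ esurj ex0 exS] Q0]]]]]]]]].
  (* Splicing: the resolution of [K] is shifted by one degree, [P] is put in degree 0, and [i \o e]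
     is the first differential. *)
  exists (cons_module P Q).
  exists (fun i' => if i' is j.+1 return {linear Q i' -> cons_module P Q i'}
    then d j else i \o e : {linear Q 0 -> P}), p; split; [split|].
  + by case.
  + by [].
  + move=> y; rewrite ex; split=> [[x <-]|[x <-]]; last by exists (e x).
    by have [z <-] := esurj x; exists z.
  + case=> [|j] //= y; rewrite -ex0; split=> [|/= ->]; last by rewrite linear0.
    exact: linear_inj0 iinj.
  + by case=> // j nj x; apply: Q0.
Qed.

Lemma inj_res_id_le n M : (exists (I : nat -> lmodType A) (e : {linear M -> I 0})
    (d : forall i, {linear I i -> I i.+1}), injective_resolution e d /\ zero_beyond I n) <-> id_le n M.
Proof.
elim: n M => [|n IHn] M; split.
- move=> [I [e [d [[injI einj ex0 _] I0]]]]; apply: (@retract_injective _ _ (I 0)) => //.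
  have [|k kP] := linear_cofactor (i := e) (t := idfun) einj.
    by move=> y; apply/ex0/I0.
  by exists e, k => m; apply: einj; rewrite kP.
- move=> injM; exists (cons_module M (fun=> zero_module)), idfun.
  exists (fun i => zero_linear _ _); split; [split|].
  + by case=> // k; exact: zero_module_injective.
  + by [].
  + by move=> y; split=> [_|_]; [exists y|exact: zero_moduleP].
  + move=> i y; split=> [_|_]; last exact: zero_moduleP.
    by exists 0; rewrite [RHS]zero_moduleP.
  + by case=> // i _ x; exact: zero_moduleP.
- move=> [I [e [d [[injI einj ex0 exS] I0]]]].
  have [d0 d0P] := linear_corestrict (submod_im (d 0)) (h := d 0) (fun x => ex_intro _ x erefl).
  exists (I 0), (submod (submod_im (d 0))), e, d0; split=> //.
  + move=> y; rewrite -ex0 -d0P; split=> [->|]; first by rewrite linear0.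
    by apply: linear_inj0; exact: submod_incl_inj.
  + case=> y [x xy]; exists x; apply/submod_val_inj; rewrite /= -xy; exact: d0P.
  apply/IHn; exists (fun i => I i.+1), (submod_incl (submod_im (d 0))), (fun i => d i.+1).
  split; last by move=> i ni; apply: I0.
  split=> //; first exact: submod_incl_inj.
  move=> y; rewrite exS; split=> [yim|[[x xim] <-] //].
  by exists (Submod (submod_im (d 0)) yim).
- move=> [I [C [j [p [injI jinj ex psurj /IHn[Q [e [d [[injQ einj ex0 exS] Q0]]]]]]]]].
  exists (cons_module I Q), j.
  exists (fun i' => if i' is k.+1 return {linear cons_module I Q i' -> Q i'}
    then d k else e \o p : {linear I -> Q 0}); split; [split|].
  + by case.
  + by [].
  + move=> y; rewrite -ex /=; split=> [|/= ->]; last by rewrite linear0.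
    exact: linear_inj0 einj.
  + case=> [|k] //= y; rewrite ex0; split=> [[x <-]|[x <-]]; last by exists (p x).
    by have [z <-] := psurj x; exists z.
  + by case=> // k nk x; apply: Q0.
Qed.

Lemma pd_leS_mono n m M : (n <= m)%N -> pd_le n M -> pd_le m M.
Proof.
move=> nm /proj_res_pd_le[P [d [e [res P0]]]]; apply/proj_res_pd_le.
by exists P, d, e; split=> // i mi; apply/P0/(leq_ltn_trans nm).
Qed.

Lemma leastP (S : nat -> Prop) n : (forall i j, (i <= j)%N -> S i -> S j) ->
  (dim_le (least S) n : Prop) <-> S n.
Proof.
move=> mono; rewrite /least; case: pselect => [ex|nex] /=; last first.
  by split=> // Sn; case: nex; exists n; apply/asboolP.
case: ex_minnP => k /asboolP Sk kmin; split=> [kn|Sn]; first exact: mono Sk.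
by apply: kmin; apply/asboolP.
Qed.

Lemma least_neq_None (S : nat -> Prop) : least S <> None <-> exists n, S n.
Proof.
rewrite /least; case: pselect => [[n Sn]|nex]; split=> //.
  by move=> _; exists n; apply/asboolP.
by case=> n Sn; case: nex; exists n; apply/asboolP.
Qed.

Lemma proj_dimE M : proj_dim M = least (pd_le^~ M).
Proof. by congr least; apply/funext => n; apply/propext/proj_res_pd_le. Qed.

Lemma inj_dimE M : inj_dim M = least (id_le^~ M).
Proof. by congr least; apply/funext => n; apply/propext/inj_res_id_le. Qed.

Lemma proj_dim_le M n : (dim_le (proj_dim M) n : Prop) <-> pd_le n M.
Proof. by rewrite proj_dimE; apply: leastP => i j; apply: pd_leS_mono. Qed.

(** Adding [P] to the cover [Q] as well leaves the syzygy [K] unchanged. *)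
Lemma pd_le_addl n P M : projective P -> pd_le n M -> pd_le n (P * M)%type.
Proof.
case: n => [|n] projP /=; first exact: pair_projective.
move=> [Q [K [i [p [projQ iinj ex psurj pdK]]]]].
have ilin a (x y : K) : (0, i (a *: x + y)) = a *: (0, i x) + (0, i y) :> (P * Q)%type.
  by congr pair; rewrite ?linearP //= scaler0 addr0.
have plin a (x y : P * Q) : ((a *: x + y).1, p (a *: x + y).2) =
    a *: (x.1, p x.2) + (y.1, p y.2) :> (P * M)%type.
  by congr pair; rewrite linearP.
exists (P * Q)%type, K, (make_linear ilin), (make_linear plin); split=> //.
- exact: pair_projective.
- by move=> x y [/iinj].
- move=> [u v] /=; split=> [[-> /ex[x <-]]|[x [<- <-]]]; first by exists x.
  by congr pair; apply/ex; exists x.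
- by move=> [u v]; have [w <-] := psurj v; exists (u, w).
Qed.

Lemma id_le_addl n I M : injective_module I -> id_le n M -> id_le n (I * M)%type.
Proof.
case: n => [|n] injI /=; first exact: pair_injective.
move=> [J [C [j [p [injJ jinj ex psurj idC]]]]].
have jlin a (x y : I * M) : ((a *: x + y).1, j (a *: x + y).2) =
    a *: (x.1, j x.2) + (y.1, j y.2) :> (I * J)%type.
  by congr pair; rewrite linearP.
have plin a (x y : I * J) : p (a *: x + y).2 = a *: p x.2 + p y.2 by rewrite linearP.
exists (I * J)%type, C, (make_linear jlin), (make_linear plin); split=> //.
- exact: pair_injective.
- by move=> [u v] [u' v'] [<- /jinj<-].
- move=> [u v] /=; split=> [/ex[x <-]|[[u' x] [_ <-]]]; first by exists (u, x).
  by apply/ex; exists x.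
- by move=> v; have [w <-] := psurj v; exists (0, w).
Qed.

(* If [eta] lifts the projection of X onto the complement of M, then the kernel of
   P -> X -> M is a retract of P * K, by z |-> (z, z - eta z) and (w, k) |-> eta w + k. *)
Lemma retract_pd_le n M X : retract M X -> pd_le n X -> pd_le n M.
Proof.
elim: n M X => [|n IHn] M X; first exact: retract_projective.
move=> [s [r rs]] [P [K [i [p [projP iinj ex psurj pdK]]]]].
have [eta etaP] := projP _ _ p (complement_linear (s \o r) \o p : {linear P -> X}) psurj.
have {}etaP z : p (eta z) = p z - s (r (p z)) by rewrite etaP.
pose rp : {linear P -> M} := r \o p.
pose K' := submod (submod_ker rp).
exists P, K', (submod_incl _), rp; split=> //.
- exact: submod_incl_inj.
- move=> y; split=> [y0|[x <-]]; last exact: submod_valP x.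
  by exists (Submod (submod_ker rp) y0).
- by move=> m; have [z zm] := psurj (s m); exists z; rewrite /= zm rs.
apply: (IHn _ (P * K)%type); last exact: pd_le_addl.
have [|b bP] := linear_cofactor
    (t := complement_linear eta \o submod_incl (submod_ker rp) : {linear K' -> P}) iinj.
  move=> [z z0] /=; apply/ex; rewrite linearB etaP opprB addrC subrK.
  by have -> : r (p z) = 0; rewrite ?linear0.
have alin a (x y : K') : (submod_incl _ (a *: x + y), b (a *: x + y)) =
    a *: (submod_incl _ x, b x) + (submod_incl _ y, b y) :> (P * K)%type.
  by congr pair; rewrite linearP.
have clin a (u v : P * K) : eta (a *: u + v).1 + i (a *: u + v).2 =
    a *: (eta u.1 + i u.2) + (eta v.1 + i v.2).
  by rewrite /= !linearP scalerDr addrACA.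
have [|c cP] := linear_corestrict (submod_ker rp) (h := make_linear clin).
  move=> [w k] /=; rewrite linearD /= etaP (_ : p (i k) = 0); last by apply/ex; exists k.
  by rewrite addr0 linearB /= rs subrr.
exists (make_linear alin), c => z; apply: (@submod_incl_inj _ _ _ (submod_ker rp)).
by rewrite cP /= bP /= addrC subrK.
Qed.

(** Dual to [retract_pd_le]. Here [eta] extends [j (1 - s r)] along [j], and the image [Q] of
    [(eta, p)] is the cokernel of [j \o s]. It is a retract of [I * C] by the map sending [(y, p z)]
    to the class of [y + z - eta z]. *)
Lemma retract_id_le n M X : retract M X -> id_le n X -> id_le n M.
Proof.
elim: n M X => [|n IHn] M X; first exact: retract_injective.
move=> [s [r rs]] [I [C [j [p [injI jinj ex psurj idC]]]]].
have [eta etaP] := injI _ _ j (j \o complement_linear (s \o r) : {linear X -> I}) jinj.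
have {}etaP x : eta (j x) = j x - j (s (r x)) by rewrite etaP /= linearB.
have qlin a x y : (eta (a *: x + y), p (a *: x + y)) =
    a *: (eta x, p x) + (eta y, p y) :> (I * C)%type.
  by congr pair; rewrite linearP.
pose q := make_linear qlin; pose Q := submod (submod_im q).
have [q' q'P] := linear_corestrict (submod_im q) (h := q) (fun x => ex_intro _ x erefl).
have q'0 z : q' z = 0 <-> eta z = 0 /\ p z = 0.
  split=> [q'z0|[e0 p0]].
    by have := q'P z; rewrite q'z0 linear0 => -[<- <-].
  by apply: (@submod_incl_inj _ _ _ (submod_im q)); rewrite q'P linear0 /= e0 p0.
exists I, Q, (j \o s : {linear M -> I}), q'; split=> //.
- by move=> x y /jinj /(congr1 r); rewrite !rs.
- move=> z; rewrite q'0; split=> [[e0 /ex[x xz]]|[m <-]] /=.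
    exists (r x); move: e0; by rewrite -xz etaP => /subr0_eq <-.
  by rewrite etaP rs subrr; split=> //; apply/ex; exists (s m).
- case=> y [x xy]; exists x; apply/submod_val_inj; rewrite /= -xy; exact: q'P.
apply: (IHn _ (I * C)%type); last exact: id_le_addl.
have [|t tP] := linear_factor (t := q' \o complement_linear eta : {linear I -> Q}) psurj.
  move=> z /ex[x <-] /=; apply/q'0.
  rewrite etaP opprB addrC subrK etaP rs subrr; split=> //.
  by apply/ex; exists (s (r x)).
have blin a (u v : I * C) : q' (a *: u + v).1 + t (a *: u + v).2 =
    a *: (q' u.1 + t u.2) + (q' v.1 + t v.2).
  by rewrite /= !linearP scalerDr addrACA.
exists (submod_incl _), (make_linear blin) => -[y [x xy]].
subst y; rewrite /= tP /=.
apply/(@submod_incl_inj _ _ _ (submod_im q)).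
by rewrite -linearD addrC subrK q'P.
Qed.

End Dimensions.

(** * Noetherian modules *)

Section Noetherian.
Variable A : pzRingType.
Implicit Types M N : lmodType A.

Fixpoint in_span M (s : seq M) (m : M) : Prop :=
  if s is x :: s' then exists a : A, in_span s' (m - a *: x) else m = 0.

Lemma in_span_submodule M (s : seq M) : submodule (in_span s).
Proof.
elim: s => [|x s [s0 sP]] /=; first exact: submod_set0.
split=> [|a m m' [b mb] [b' mb']]; first by exists 0; rewrite scale0r subr0.
exists (a * b + b'); have := sP a _ _ mb mb'.
by rewrite scalerDl -scalerA scalerBr opprD addrACA.
Qed.

Lemma in_span_mem M (s : seq M) x : x \in s -> in_span s x.
Proof.
elim: s => //= y s IHs; rewrite inE => /predU1P[->|/IHs xs].
  by exists 1; rewrite scale1r subrr; apply: submod0 (in_span_submodule s).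
by exists 0; rewrite scale0r subr0.
Qed.

Lemma in_span_min M (s : seq M) (S : M -> Prop) : submodule S ->
  (forall x, x \in s -> S x) -> forall m, in_span s m -> S m.
Proof.
move=> Ss; elim: s => [|x s IHs] sS m /=; first by move=> ->; apply: submod0 Ss.
case=> a /IHs Sm; rewrite -(subrK (a *: x) m); apply: (submodD Ss).
  by apply: Sm => y ys; apply: sS; rewrite inE ys orbT.
by apply: (submodZ Ss); apply: sS; rewrite mem_head.
Qed.

Lemma in_span_sub M (s t : seq M) : {subset s <= t} -> forall m, in_span s m -> in_span t m.
Proof. by move=> st; apply: in_span_min (in_span_submodule t) _ => x /st; apply: in_span_mem. Qed.

Definition fin_gen M (S : M -> Prop) :=
  exists s : seq M, (forall x, x \in s -> S x) /\ forall m, S m -> in_span s m.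

Definition noetherian M := forall S : M -> Prop, submodule S -> fin_gen S.

(** The extension argument for finite generation, run on an additive relation: preimages [e] of
    generators of the range, together with generators of the fibre over 0, generate the domain. *)
Lemma fin_gen_rel M N (Q : (M * N)%type -> Prop) : submodule Q ->
  fin_gen (fun n => exists m, Q (m, n)) -> fin_gen (fun m => Q (m, 0)) ->
  fin_gen (fun m => exists n, Q (m, n)).
Proof.
move=> Qs [t [tQ Qt]] [s [sQ Qs0]].
have /choice[e eP] n : exists m, (exists m', Q (m', n)) -> Q (m, n).
  by have [[m Qm]|nQ] := pselect (exists m, Q (m, n)); [exists m|exists 0].
exists (map e t ++ s); split=> [x|m [n Qmn]].
  rewrite mem_cat => /orP[/mapP[n nt ->]|/sQ]; last by exists 0.
  by exists n; apply/eP/tQ.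
have Ss : submodule (fun n => exists2 u, in_span (map e t) u & Q (u, n)).
  split=> [|a x y [u ut Qu] [v vt Qv]].
    by exists 0; [exact: submod0 (in_span_submodule _)|exact: submod0 Qs].
  by exists (a *: u + v); [exact: (submodP (in_span_submodule (map e t)) a ut vt)
                          |exact: (submodP Qs a Qu Qv)].
have [|u ut Qun] := in_span_min Ss _ (Qt n (ex_intro _ m Qmn)).
  move=> x xt; exists (e x); last exact/eP/tQ.
  exact/in_span_mem/map_f.
rewrite -(subrK u m); apply: (submodD (in_span_submodule (map e t ++ s))).
  apply: (@in_span_sub _ s) => [x xs|]; first by rewrite mem_cat xs orbT.
  apply: Qs0; have -> : (m - u, 0) = (m, n) - (u, n) :> (M * N)%type.
    by congr pair; rewrite subrr.
  exact: (submodB Qs Qmn Qun).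
by apply: in_span_sub ut => x xs; rewrite mem_cat xs.
Qed.

Lemma fin_gen_eq M (S T : M -> Prop) : (forall m, S m <-> T m) -> fin_gen S -> fin_gen T.
Proof. by move=> ST; have -> : S = T by apply/funext => m; apply/propext. Qed.

(** Induction on the generators. [Q] relates an element of [S] to its possible coefficients at [x]:
    these coefficients form a left ideal, and the fibre over 0 lies in the span of the remaining
    generators. *)
Lemma noetherian_span M (s : seq M) (S : M -> Prop) : noetherian A^o ->
  submodule S -> (forall m, S m -> in_span s m) -> fin_gen S.
Proof.
move=> noethA; elim: s S => [|x s IHs] S Ss sS; first by exists [::].
pose Q (z : (M * A^o)%type) := S z.1 /\ in_span s (z.1 - (z.2 : A) *: x).
have Qs : submodule Q.
  split=> [|a u v [Su su] [Sv sv]]; rewrite /Q /=.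
    rewrite scale0r subr0; split; first exact: submod0 Ss.
    exact: submod0 (in_span_submodule s).
  split; first by apply: (submodP Ss).
  have := submodP (in_span_submodule s) a su sv.
  by rewrite scalerDl -scalerA scalerBr opprD addrACA.
apply: (@fin_gen_eq _ (fun m => exists a, Q (m, a))) => [m|].
  split=> [[a []//]|Sm]; have [a ma] := sS _ Sm; by exists a.
apply: (fin_gen_rel Qs).
  apply: noethA; split=> [|a u v [m Qm] [m' Qm']]; first by exists 0; apply: submod0 Qs.
  by exists (a *: m + m'); exact: (submodP Qs a Qm Qm').
apply: IHs => [|m]; last by case; rewrite /= scale0r subr0.
split=> [|a u v Qu Qv]; first exact: submod0 Qs.
by have := submodP Qs a Qu Qv; rewrite (_ : _ + _ = (a *: u + v, 0)) //; congr pair; rewrite /= scaler0 addr0.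
Qed.

Lemma generates_span M n (x : 'I_n -> M) m : generates x -> in_span (codom x) m.
Proof.
move=> /(_ m)[a ->]; apply: (submod_sum (in_span_submodule _)) => i _.
apply: (submodZ (in_span_submodule _)); apply/in_span_mem/codom_f.
Qed.

Lemma noetherian_fg M : noetherian A^o -> finitely_generated M -> noetherian M.
Proof.
move=> noethA [n [x xgen]] S Ss; apply: (noetherian_span noethA Ss (s := codom x)) => m _.
exact: generates_span.
Qed.

(** If no member of [F] were minimal, dependent choice would iterate [next] into a strictly
    descending chain. *)
Lemma artinian_min M (F : (M -> Prop) -> Prop) : artinian_module M ->
  (exists2 S, submodule S & F S) ->
  exists S : M -> Prop, [/\ submodule S, F S
    & forall T : M -> Prop, submodule T -> F T -> (forall x, T x -> S x) -> forall x, S x -> T x].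
Proof.
move=> artM [S0 S0s FS0]; apply: contrapT => nomin.
pose good (S : M -> Prop) := submodule S /\ F S.
have /choice[next nextP] (S : {S | good S}) : exists T : {S | good S},
    (forall x, sval T x -> sval S x) /\ exists2 x, sval S x & ~ sval T x.
  case: S => S [Ss FS]; apply: contrapT => noT; apply: nomin.
  exists S; split=> // T Ts FT TS x Sx; apply: contrapT => nTx; apply: noT.
  by exists (exist good T (conj Ts FT)); split=> //; exists x.
pose N k := sval (iter k next (exist good S0 (conj S0s FS0))).
have Ns k : submodule (N k) by rewrite /N; case: (iter _ _ _) => S [].
have [n nP] := artM (fun k => fun x => `[< N k x >]) (fun k => submodule_pred (Ns k))
  (fun k x Nx => asboolT ((nextP _).1 x (asboolW Nx))).
have [x Nx] := (nextP (iter n next (exist good S0 (conj S0s FS0)))).2; apply.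
by have := nP n.+1 (leqnSn n) x; rewrite /in_mem /= [RHS]asboolT // => /asboolW.
Qed.

End Noetherian.

(* A minimal non-finitely generated ideal b satisfies r b = 0 or r b = b for every r,
   so it is a vector space over the residue field R / ann b, and a maximal subspace avoiding
   a given vector is then a finitely generated hyperplane. *)
Lemma artinian_noetherian (R : comPzRingType) : artinian_module (R^o : lmodType R) ->
  noetherian (R^o : lmodType R).
Proof.
move=> artR; apply: contrapT => nonoeth.
have [b [bs bnfg bmin]] : exists b : R^o -> Prop, [/\ submodule b, ~ fin_gen b
    & forall T : R^o -> Prop, submodule T -> ~ fin_gen T -> (forall x, T x -> b x) ->
      forall x, b x -> T x].
  apply: (@artinian_min _ R^o (fun S => ~ fin_gen S)) => //.
  apply: contrapT => allfg; apply: nonoeth => S Ss; apply: contrapT => Snfg.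
  by apply: allfg; exists S.
(* [Q] is the graph of multiplication by [r] on [b]. If its kernel and its image were both proper in
   [b], both would be finitely generated by minimality, and so would [b]. *)
have rb (r : R) : (forall x, b x -> r *: x = 0) \/ (forall x, b x -> exists2 y, b y & x = r *: y).
  apply: contrapT => /not_orP[nker nim]; apply: bnfg.
  pose Q (z : (R^o * R^o)%type) := b z.1 /\ z.2 = r *: z.1.
  have Qs : submodule Q.
    split=> [|a u v [bu uE] [bv vE]]; rewrite /Q /=.
      by rewrite scaler0; split=> //; apply: submod0 bs.
    split; first by apply: (submodP bs).
    by rewrite uE vE scalerDr !scalerA mulrC.
  apply: (@fin_gen_eq _ _ (fun m => exists n, Q (m, n))) => [m|].
    by split=> [[n []]//|bm]; exists (r *: m).
  apply: (fin_gen_rel Qs).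
    apply: contrapT => nfg; apply: nim => x bx.
    have [||y [by_ yx]] := bmin _ _ nfg _ x bx; last by exists y.
    - split=> [|a u v [m Qm] [m' Qm']]; first by exists 0; apply: submod0 Qs.
      by exists (a *: m + m'); exact: (submodP Qs a Qm Qm').
    - by move=> y [m [bm /= ->]]; apply: (submodZ bs).
  apply: contrapT => nfg; apply: nker => x bx.
  have [||_ /= <-//] := bmin _ _ nfg _ x bx; last by move=> y [].
  split=> [|a u v Qu Qv]; first exact: submod0 Qs.
  by have := submodP Qs a Qu Qv; rewrite (_ : _ + _ = (a *: u + v, 0)) //; congr pair; rewrite /= scaler0 addr0.
have [x0 bx0 x0n0] : exists2 x, b x & x <> 0.
  apply: contrapT => b0; apply: bnfg; exists [::]; split=> // m bm.
  by apply: contrapT => m0; apply: b0; exists m.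
(* The hyperplane [W]: it omits [x0], so it is proper in [b], hence finitely generated. The claim is
   that [b] is generated by [x0] and [W]. *)
have [|W [Ws _ Wb Wmax]] := @maximal_submodule _ R^o (fun z => b z /\ z <> x0) _ (submod_set0 _).
  by move=> _ ->; split; [exact: submod0 bs|move=> z; apply: x0n0].
have [s [sW Wsp]] : fin_gen W.
  apply: contrapT => Wnfg; have := bmin W Ws Wnfg (fun x Wx => (Wb x Wx).1) x0 bx0.
  by move=> /Wb[].
apply: bnfg; exists (x0 :: s); split=> [x|v bv].
  by rewrite inE => /predU1P[->//|/sW/Wb[]].
have [Wv|nWv] := pselect (W v).
  by apply: in_span_sub (Wsp v Wv) => x xs; rewrite inE xs orbT.
pose W' z := exists x y : R^o, [/\ W x, exists a : R, y = a *: v & z = x + y].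
have [w [r [Ww x0E]]] : exists w (r : R), W w /\ x0 = w + r *: v.
  apply: contrapT => nx0; apply: nWv; apply: (Wmax W').
  - exact: submod_add Ws (submod_cyclic _).
  - by move=> x Wx; exists x, 0; rewrite addr0; split=> //; exists 0; rewrite scale0r.
  - move=> _ [x [_ [Wx [a ->] ->]]]; split.
      by apply: (submodD bs); [case: (Wb x Wx)|apply: (submodZ bs)].
    by move=> xE; apply: nx0; exists x, a.
  - exists 0, v; rewrite add0r; split=> //; first exact: submod0 Ws.
    by exists 1; rewrite scale1r.
have [r0|rK] := rb r.
  by case: (Wb w Ww) => _ []; rewrite x0E r0 ?addr0.
(* An inverse of [r] on [b]: the chain of principal ideals of the powers of [r] stops, so
   [r ^+ k = c * r ^+ k.+1] for some [c]; as [b] equals [r ^+ k] times [b], the product [c * r] acts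
   on [b] as the identity. *)
pose P (k : nat) (x : R^o) := exists c : R, x = c *: (r ^+ k : R^o).
have [_ [_ [k ->] kmin]] : exists T : R^o -> Prop, [/\ submodule T, exists k, T = P k
    & forall T' : R^o -> Prop, submodule T' -> (exists k, T' = P k) ->
      (forall x, T' x -> T x) -> forall x, T x -> T' x].
  by apply: (artinian_min artR); exists (P 0%N); [exact: submod_cyclic|exists 0%N].
have [||c cP] := kmin (P k.+1) (submod_cyclic _) (ex_intro _ k.+1 erefl) _ (r ^+ k) (ex_intro _ 1 _).
- by move=> _ [c ->]; exists (c * r); rewrite exprS /GRing.scale /= mulrA.
- by rewrite scale1r.
have rKn : forall j x, b x -> exists2 y, b y & x = r ^+ j *: y.
  elim=> [|j IHj] x bx; first by exists x => //; rewrite expr0 scale1r.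
  have [y by_ ->] := IHj x bx; have [z bz ->] := rK y by_.
  by exists z => //; rewrite exprSr scalerA.
have cr y : b y -> c *: (r *: y) = y.
  by move=> /(rKn k)[z bz ->]; rewrite !scalerA -mulrA -exprS -[c * _]cP.
rewrite -(cr v bv) (_ : r *: v = x0 - w); last by rewrite x0E addrC addKr.
apply: (submodZ (in_span_submodule _)); apply: (submodB (in_span_submodule _)).
  by apply: in_span_mem; rewrite mem_head.
by apply: in_span_sub (Wsp w Ww) => x xs; rewrite inE xs orbT.
Qed.

Lemma submodule_restr (L G : pzRingType) (f : {rmorphism L -> G}) (M : lmodType G) (S : M -> Prop) :
  submodule S -> submodule (S : restr f M -> Prop).
Proof. by case=> S0 SP; split=> // a; apply: SP. Qed.

(** A left ideal of [G] is an [L]-submodule, and generators over [L] still generate over [G]. *)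
Lemma noetherian_ext (L G : pzRingType) (f : {rmorphism L -> G}) :
  finitely_generated (left_ext f) -> noetherian L^o -> noetherian G^o.
Proof.
move=> Gfg /noetherian_fg/(_ Gfg) noeth S Ss.
have [s [sS Ss_]] := noeth _ (submodule_restr f Ss).
exists s; split=> // m /Ss_.
apply: (@in_span_min _ (left_ext f) s (@in_span G G^o s)) => [|x xs]; last exact: (@in_span_mem G G^o s x xs).
exact: submodule_restr (in_span_submodule _).
Qed.

Lemma artin_algebra_noetherian (A : pzRingType) : artin_algebra A -> noetherian A^o.
Proof.
by case=> R [phi [artR _ Afg]]; apply: noetherian_ext Afg (artinian_noetherian artR).
Qed.

(** * Characters *)

Section Quotient.
Variables (A : pzRingType) (M : lmodType A) (S : M -> Prop) (Ssub : submodule S).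

(** The chosen representative of the coset of [x]; the quotient is the type of fixed points of
    [repr], so equal cosets are equal elements. *)
Let repr x := choose (fun y => `[< S (x - y) >]) x.

Let repr_congr x : S (x - repr x).
Proof.
have Px : `[< S (x - x) >] by apply/asboolT; rewrite subrr; apply: submod0.
exact: (asboolW (@chooseP _ (fun y => `[< S (x - y) >]) x Px)).
Qed.

Let repr_congrV x : S (repr x - x).
Proof. by rewrite -opprB -scaleN1r; apply: submodZ. Qed.

Let reprP x y : S (x - y) -> repr x = repr y.
Proof.
move=> Sxy; rewrite /repr -(@choose_id _ (fun z => `[< S (y - z) >]) x y); last first.
- by apply/asboolT; rewrite subrr; apply: submod0.
- by apply/asboolT; rewrite -opprB -scaleN1r; apply: submodZ.
apply: eq_choose => z; apply/asbool_equiv_eq; split=> Sz.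
  by rewrite -(subrK x y) -addrA; apply: submodD => //; rewrite -opprB -scaleN1r; apply: submodZ.
by rewrite -(subrK y x) -addrA; apply: submodD.
Qed.

Record quotient_of (Ssub : submodule S) :=
  Quotient { quotient_repr : M; _ : repr quotient_repr = quotient_repr }.
Notation quotient := (quotient_of Ssub).

HB.instance Definition _ := gen_eqMixin quotient.
HB.instance Definition _ := gen_choiceMixin quotient.

Let repr_repr x : repr (repr x) = repr x.
Proof. by apply/esym/reprP/repr_congr. Qed.

Definition quotient_proj x : quotient := Quotient Ssub (repr_repr x).
Local Notation pi := quotient_proj.

Let pi_eq x y : S (x - y) -> pi x = pi y.
Proof.
move=> /reprP xy; rewrite /pi; move: (repr_repr x) (repr_repr y); rewrite xy => p q.
by congr Quotient; apply: Prop_irrelevance.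
Qed.

Let piK (q : quotient) : pi (quotient_repr q) = q.
Proof.
case: q => x xP; rewrite /pi /=; move: (repr_repr x); rewrite xP => p.
by congr Quotient; apply: Prop_irrelevance.
Qed.

Let scale a (q : quotient) := pi (a *: quotient_repr q).
Let add (p q : quotient) := pi (quotient_repr p + quotient_repr q).
Let opp (q : quotient) := pi (- quotient_repr q).

Let piZ a x : scale a (pi x) = pi (a *: x).
Proof. by apply: pi_eq; rewrite -scalerBr; apply: submodZ => //; apply: repr_congrV. Qed.
Let piD x y : add (pi x) (pi y) = pi (x + y).
Proof. by apply: pi_eq; rewrite opprD addrACA; apply: submodD => //; apply: repr_congrV. Qed.
Let piN x : opp (pi x) = pi (- x).
Proof. by rewrite -scaleN1r -piZ /scale scaleN1r. Qed.

Let addA : associative add.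
Proof. by move=> p q r; rewrite -[p]piK -[q]piK -[r]piK !piD addrA. Qed.
Let addC : commutative add.
Proof. by move=> p q; rewrite -[p]piK -[q]piK !piD addrC. Qed.
Let add0 : left_id (pi 0) add.
Proof. by move=> p; rewrite -[p]piK !piD add0r. Qed.
Let addN : left_inverse (pi 0) opp add.
Proof. by move=> p; rewrite -[p]piK piN piD addNr. Qed.
HB.instance Definition _ := GRing.isZmodule.Build quotient addA addC add0 addN.

Let scaleA a b x : scale a (scale b x) = scale (a * b) x.
Proof. by rewrite -[x]piK !piZ scalerA. Qed.
Let scale1 : left_id 1 scale.
Proof. by move=> x; rewrite -[x]piK !piZ scale1r. Qed.
Let scaleDr : right_distributive scale +%R.
Proof.
move=> a x y; change (scale a (add x y) = add (scale a x) (scale a y)).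
by rewrite -[x]piK -[y]piK piD !piZ piD scalerDr.
Qed.
Let scaleDl x : {morph scale^~ x : a b / a + b}.
Proof.
move=> a b; change (scale (a + b) x = add (scale a x) (scale b x)).
by rewrite -[x]piK !piZ piD scalerDl.
Qed.
HB.instance Definition _ := GRing.Zmodule_isLmodule.Build A quotient scaleA scale1 scaleDr scaleDl.

Let pi_linear a x y : pi (a *: x + y) = a *: pi x + pi y.
Proof. by change (pi (a *: x + y) = add (scale a (pi x)) (pi y)); rewrite piZ piD. Qed.
Definition quotient_map : {linear M -> quotient} := make_linear pi_linear.

Lemma quotient_map_surj : surjective quotient_map.
Proof. by move=> q; exists (quotient_repr q); apply: piK. Qed.

Lemma quotient_map_eq0 x : quotient_map x = 0 <-> S x.
Proof.
split=> [/(congr1 (@quotient_repr Ssub)) /= x0|Sx]; last by apply: pi_eq; rewrite subr0.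
have := submodB Ssub (repr_congr x) (repr_congr 0).
by rewrite x0 opprB subrKA subr0.
Qed.
End Quotient.

(** * The group Q/Z as an injective cogenerator of abelian groups *)

Definition integral (x : zmodule rat) := exists n : int, x = n%:~R :> rat.

Lemma integral_submodule : submodule integral.
Proof.
split=> [|a _ _ [n ->] [m ->]]; first by exists 0.
by exists (a * n + m); rewrite rmorphD rmorphM /= scalezrE mulrzl.
Qed.

Definition rat_mod_int := quotient_of integral_submodule.

Lemma rat_mod_int_divisible (d : nat) (t : rat_mod_int) : (0 < d)%N ->
  exists u, d%:Z *: u = t.
Proof.
move=> d0; have [q <-] := quotient_map_surj t.
exists (quotient_map integral_submodule ((q : rat) / d%:R)); rewrite -linearZ; congr (quotient_map _ _).
change ((q : rat) / d%:R *~ d = q :> rat).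
by rewrite -pmulrn -[LHS]mulr_natr divfK // pnatr_eq0 -lt0n.
Qed.

Lemma rat_mod_int_torsion (d : nat) : (1 < d)%N ->
  exists t : rat_mod_int, t <> 0 /\ d%:Z *: t = 0.
Proof.
move=> d1; have d0 : d%:R != 0 :> rat by rewrite pnatr_eq0 -lt0n (ltn_trans _ d1).
exists (quotient_map integral_submodule (d%:R^-1 : rat)); split.
  move=> /quotient_map_eq0[n /(congr1 (fun x => x * d%:R))]; rewrite mulVf // => /eqP.
  rewrite -[1]/(1%:~R) -[d%:R]/(d%:~R) -intrM eqr_int => /eqP nd.
  have : absz (n * Posz d) = 1%N by rewrite -nd.
  by rewrite abszM /= => /eqP; rewrite muln_eq1 => /andP[_ /eqP d1']; rewrite d1' in d1.
rewrite -linearZ; apply/quotient_map_eq0; exists 1.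
change ((d%:R^-1 : rat) *~ d = 1).
by rewrite -pmulrn -[LHS]mulr_natr mulVf.
Qed.

Lemma least_positive (P : int -> Prop) : (exists2 n, n <> 0 & P n) ->
  (forall n, P n -> P (- n)) ->
  exists d : nat, [/\ (0 < d)%N, P d & forall k : nat, (0 < k)%N -> P k -> (d <= k)%N].
Proof.
move=> [n n0 Pn] PN; have ex : exists k, (0 < k)%N && `[< P (Posz k) >].
  exists `|n|%N; rewrite absz_gt0; apply/andP; split; first exact/eqP.
  by apply/asboolT; case: (intP n) Pn => [|k|k] //= /PN; rewrite opprK.
case: (ex_minnP ex) => d /andP[d0 /asboolW Pd] dmin; exists d; split=> // k k0 Pk.
by apply: dmin; rewrite k0; apply/asboolT.
Qed.

(** Baer's criterion over the integers: by division with remainder the least positive element [d]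
    generates the domain, and divisibility supplies the value at 1. *)
Lemma rat_mod_int_injective : injective_module (rat_mod_int : lmodType int).
Proof.
apply: baer_injective => H Hs H0.
have [ex|nex] := pselect (exists2 a : int, a <> 0 & exists j, H (a, j)); last first.
  exists 0 => a j Haj; have a0 : a = 0 by apply: contrapT => a0; apply: nex; exists a => //; exists j.
  by rewrite scaler0; apply/esym/H0; rewrite -a0.
have [|d [d0 [j Hdj] dmin]] := least_positive ex.
  by move=> a [j Haj]; exists (- j); have := submodZ Hs (-1) Haj; rewrite scaleN1r.
have [i iE] := rat_mod_int_divisible j d0; exists i => a j' Haj'.
have Hr : H ((a %% d)%Z : int, j' - (a %/ d)%Z *: j).
  have := submodB Hs Haj' (submodZ Hs (a %/ d)%Z Hdj).
  rewrite (_ : _ - _ = ((a %% d)%Z, j' - (a %/ d)%Z *: j)) //; congr pair.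
have d0z : d%:Z != 0 by rewrite eqz_nat -lt0n.
have r0 : (a %% d)%Z = 0.
  have [r rE] : exists r : nat, (a %% d)%Z = r.
    by exists `|(a %% d)%Z|%N; rewrite gez0_abs // modz_ge0.
  have rlt : (r < d)%N by rewrite -ltz_nat -rE ltz_mod.
  rewrite rE; case: r rE rlt => // r rE rlt.
  by have := dmin r.+1 isT; rewrite -rE leqNgt rlt => /(_ (ex_intro _ _ Hr)).
rewrite r0 in Hr; move/H0/subr0_eq: Hr => ->.
by rewrite {1}(divz_eq a d) r0 addr0 -scalerA iE.
Qed.

(** A non-zero [t] is chosen that is killed by every integer [k] with [k *: b] in [S]. Then
    [s + k *: b] may be sent to [k *: t], and this extends to [B] by injectivity. *)
Lemma character_separation (B : lmodType int) (S : B -> Prop) (b : B) : submodule S -> ~ S b ->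
  exists chi : {linear B -> rat_mod_int}, (forall x, S x -> chi x = 0) /\ chi b <> 0.
Proof.
move=> Ss nSb.
have [t [t0 tb]] : exists t : rat_mod_int, t <> 0 /\ forall k : int, S (k *: b) -> k *: t = 0.
  have [ex|nex] := pselect (exists2 k : int, k <> 0 & S (k *: b)); last first.
    (* No non-zero multiple of [b] lies in [S], so any non-zero [t] will do; the order 2 is
       arbitrary. *)
    have [t [t0 _]] := rat_mod_int_torsion (isT : 1 < 2)%N; exists t; split=> // k Sk.
    have -> : k = 0 by apply: contrapT => k0; apply: nex; exists k.
    by rewrite scale0r.
  have [|d [d0 Sd dmin]] := least_positive ex.
    by move=> k Sk; rewrite scaleNr -scaleN1r; apply: submodZ.
  have d1 : (1 < d)%N.
    by rewrite ltn_neqAle d0 andbT; apply/eqP => d1; apply: nSb; rewrite -d1 scale1r in Sd.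
  have [t [t0 dt]] := rat_mod_int_torsion d1; exists t; split=> // k Sk.
  have d0z : d%:Z != 0 by rewrite eqz_nat -lt0n.
  have Sr : S ((k %% d)%Z *: b).
    have := submodB Ss Sk (submodZ Ss (k %/ d)%Z Sd).
    by rewrite scalerA -scalerBl.
  have r0 : (k %% d)%Z = 0.
    have [r rE] : exists r : nat, (k %% d)%Z = r.
      by exists `|(k %% d)%Z|%N; rewrite gez0_abs // modz_ge0.
    have rlt : (r < d)%N by rewrite -ltz_nat -rE ltz_mod.
    rewrite rE; case: r rE rlt => // r rE rlt.
    by have := dmin r.+1 isT; rewrite -rE leqNgt rlt => /(_ Sr).
  by rewrite (divz_eq k d) r0 addr0 -scalerA dt scaler0.
pose H (z : (B * rat_mod_int)%type) := exists s (k : int), S s /\ z = (s + k *: b, k *: t).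
have Hs : submodule H.
  split=> [|a _ _ [s [k [Sk ->]]] [s' [k' [Sk' ->]]]].
    by exists 0, 0; rewrite !scale0r addr0; split=> //; apply: submod0.
  exists (a *: s + s'), (a * k + k'); split; first by apply: (submodP Ss).
  by rewrite !scalerDl -!scalerA addrACA -scalerDr.
have [|chi chiP] := injective_graph rat_mod_int_injective Hs.
  move=> _ [s [k [Sk [/eqP + ->]]]]; rewrite eq_sym addr_eq0 => /eqP sE; apply: tb.
  by rewrite -[k *: b]opprK -sE -scaleN1r; apply: submodZ.
exists chi; split=> [x Sx|]; first by apply: chiP; exists x, 0; rewrite !scale0r addr0.
by rewrite (chiP b t) //; exists 0, 1; rewrite !scale1r add0r; split=> //; apply: submod0.
Qed.

(** [act] is a right action on the source, so [(a f)(x) = f (x a)] is a left action on functions,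
    and [P] is a group of additive functions stable under it. *)
Record hom_spec (G : pzRingType) (B T : zmodType) (act : B -> G -> B) (P : (B -> T) -> Prop) := {
  hom_act1 : forall x, act x 1 = x;
  hom_actM : forall x a b, act x (a * b) = act (act x a) b;
  hom_actD : forall x a b, act x (a + b) = act x a + act x b;
  hom_additive : forall f, P f -> forall x y, f (x + y) = f x + f y;
  hom_closed0 : P (fun=> 0);
  hom_closedB : forall f g, P f -> P g -> P (fun x => f x - g x);
  hom_closed_act : forall f a, P f -> P (fun x => f (act x a))
}.

(* Covers both Hom_L(G, X), with G acting by right multiplication, and the character
   module Hom(X, Q/Z) of a left module X, which is a right module. *)
Record hom (G : pzRingType) (B T : zmodType) (act : B -> G -> B) (P : (B -> T) -> Prop)
  (spec : hom_spec act P) := Hom { hom_fun :> B -> T; homP : P hom_fun }.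

Section HomModule.
Variables (G : pzRingType) (B T : zmodType) (act : B -> G -> B) (P : (B -> T) -> Prop).
Variable spec : hom_spec act P.
Notation H := (hom spec).

HB.instance Definition _ := gen_eqMixin H.
HB.instance Definition _ := gen_choiceMixin H.

Lemma hom_ext (f g : H) : f =1 g -> f = g.
Proof.
case: f g => f fP [g gP] /= /funext fg; subst g.
by congr Hom; apply: Prop_irrelevance.
Qed.

Let zero : H := Hom spec (hom_closed0 spec).
(** Closure is only recorded for differences: [- f] is [0 - f], and [f + g] is [f - (0 - g)]. *)
Let opp (f : H) : H := Hom spec (hom_closedB spec (homP zero) (homP f)).
Let add (f g : H) : H := Hom spec (hom_closedB spec (homP f) (homP (opp g))).
Let addE f g x : add f g x = f x + g x. Proof. by rewrite /= sub0r opprK. Qed.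
Let addA : associative add.
Proof. by move=> f g h; apply: hom_ext => x; rewrite !addE addrA. Qed.
Let addC : commutative add.
Proof. by move=> f g; apply: hom_ext => x; rewrite !addE addrC. Qed.
Let add0 : left_id zero add.
Proof. by move=> f; apply: hom_ext => x; rewrite !addE add0r. Qed.
Let addN : left_inverse zero opp add.
Proof. by move=> f; apply: hom_ext => x; rewrite !addE /= sub0r addNr. Qed.
HB.instance Definition _ := GRing.isZmodule.Build H addA addC add0 addN.

Lemma homDE (f g : H) x : (f + g) x = f x + g x. Proof. exact: addE. Qed.

Let scale (a : G) (f : H) : H := Hom spec (hom_closed_act spec a (homP f)).
Let scaleA a b x : scale a (scale b x) = scale (a * b) x.
Proof. by apply: hom_ext => y; rewrite /= (hom_actM spec). Qed.
Let scale1 : left_id 1 scale.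
Proof. by move=> f; apply: hom_ext => y; rewrite /= (hom_act1 spec). Qed.
Let scaleDr : right_distributive scale +%R.
Proof. by move=> a f g; apply: hom_ext => x; rewrite homDE /= !sub0r !opprK. Qed.
Let scaleDl x : {morph scale^~ x : a b / a + b}.
Proof.
by move=> a b; apply: hom_ext => y; rewrite homDE /= (hom_actD spec) (hom_additive spec (homP x)).
Qed.
HB.instance Definition _ := GRing.Zmodule_isLmodule.Build G H scaleA scale1 scaleDr scaleDl.

Lemma homZE a (f : H) x : (a *: f) x = f (act x a). Proof. by []. Qed.

Lemma hom0E x : (0 : H) x = 0. Proof. by []. Qed.

Lemma hom_sumE I (r : seq I) (Q : pred I) (F : I -> H) x :
  (\sum_(i <- r | Q i) F i) x = \sum_(i <- r | Q i) F i x.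
Proof. by elim/big_rec2: _ => // i u v _ <-; rewrite homDE. Qed.
End HomModule.

(** * Restriction and induction *)

Section Restriction.
Variables (L G : pzRingType) (f : {rmorphism L -> G}).

Lemma restrZE (M : lmodType G) (a : L) (m : restr f M) : a *: m = f a *: (m : M).
Proof. by []. Qed.

Lemma restr_linear_proof (X Y : lmodType G) (h : {linear X -> Y}) (a : L) (x y : restr f X) :
  h (a *: x + y) = a *: (h x : restr f Y) + (h y : restr f Y) :> restr f Y.
Proof. exact: (linearP h (f a) x y). Qed.
Definition restr_map (X Y : lmodType G) (h : {linear X -> Y}) : {linear restr f X -> restr f Y} :=
  make_linear (X := restr f X) (Y := restr f Y) (h := h) (restr_linear_proof h).

Lemma restr_pd_le n (M : lmodType G) :
  (forall P : lmodType G, projective P -> projective (restr f P)) ->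
  pd_le n M -> pd_le n (restr f M).
Proof.
move=> rproj; elim: n M => [|n IHn] M; first exact: rproj.
case=> [P [K [i [p [projP iinj ex psurj /IHn pdK]]]]].
by exists (restr f P), (restr f K), (restr_map i), (restr_map p); split=> //; apply: rproj.
Qed.

Lemma restr_id_le n (M : lmodType G) :
  (forall I : lmodType G, injective_module I -> injective_module (restr f I)) ->
  id_le n M -> id_le n (restr f M).
Proof.
move=> rinj; elim: n M => [|n IHn] M; first exact: rinj.
case=> [I [C [j [p [injI jinj ex psurj /IHn idC]]]]].
by exists (restr f I), (restr f C), (restr_map j), (restr_map p); split=> //; apply: rinj.
Qed.
End Restriction.

Definition make_rmorphism (R S : pzRingType) (h : R -> S) (hB : zmod_morphism h)
    (hM : monoid_morphism h) : {rmorphism R -> S} :=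
  HB.pack h (GRing.isZmodMorphism.Build R S h hB) (GRing.isMonoidMorphism.Build R S h hM).

(** * Twisting modules by a ring automorphism *)

Section Automorphism.
Variables (L : pzRingType) (s t : {rmorphism L -> L}).
Hypothesis (st : cancel t s) (ts : cancel s t).

(** Twisting by [s] and by its inverse [t] are inverse equivalences: the same functions are linear
    into [restr s I] and from [restr t X] into [I]. So the extension problem is solved after
    twisting the source. *)
Lemma restr_aut_injective (I : lmodType L) : injective_module I -> injective_module (restr s I).
Proof.
move=> injI X Y i h iinj.
have hlin (a : L) (x y : restr t X) : (h (a *: x + y) : I) = a *: (h x : I) + (h y : I) :> I.
  by rewrite -[in RHS](st a); apply: (linearP h (t a) x y).
have [k kP] := injI _ _ (restr_map t i) (make_linear (X := restr t X) (Y := I) (h := h) hlin) iinj.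
have klin (a : L) (x y : Y) : k (a *: x + y) = a *: (k x : restr s I) + (k y : restr s I) :> restr s I.
  by rewrite -[in LHS](ts a); apply: (linearP k (s a) x y).
by exists (make_linear (X := Y) (Y := restr s I) (h := k) klin).
Qed.

Lemma restr_aut_projective (P : lmodType L) : projective P -> projective (restr s P).
Proof.
move=> projP X Y i h isurj.
have hlin (a : L) (x y : P) : h (a *: x + y) = a *: (h x : restr t Y) + (h y : restr t Y) :> restr t Y.
  by rewrite -[in LHS](st a); apply: (linearP h (t a) x y).
have [k kP] := projP _ _ (restr_map t i) (make_linear (X := P) (Y := restr t Y) (h := h) hlin) isurj.
have klin (a : L) (x y : restr s P) : (k (a *: x + y) : X) = a *: (k x : X) + (k y : X) :> X.
  by rewrite -[in RHS](ts a); apply: (linearP k (s a) x y).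
by exists (make_linear (X := restr s P) (Y := X) (h := k) klin).
Qed.
End Automorphism.

(** The basis condition, written with products in [G]. Passing to the converse rings only exchanges
    the left and right fields, so results on left modules also serve for right modules. *)
Record normalizing_basis (L G : pzRingType) (f : {rmorphism L -> G}) n (g : 'I_n -> G) : Prop := {
  right_gen : forall x, exists a : 'I_n -> L, x = \sum_i g i * f (a i);
  right_free : forall a : 'I_n -> L, \sum_i g i * f (a i) = 0 -> forall i, a i = 0;
  left_gen : forall x, exists a : 'I_n -> L, x = \sum_i f (a i) * g i;
  left_free : forall a : 'I_n -> L, \sum_i f (a i) * g i = 0 -> forall i, a i = 0;
  normalizing : forall i x, (exists a, x = f a * g i) <-> (exists b, x = g i * f b)
}.

Lemma excellent_normalizing_basis (L G : pzRingType) (f : {rmorphism L -> G}) :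
  excellent_extension f -> exists n (g : 'I_n -> G), normalizing_basis f g.
Proof.
case=> _ [n [g [[rgen rfree] [lgen lfree] norm]]]; exists n, g.
split; [exact: rgen|exact: rfree|exact: lgen|exact: lfree|exact: norm].
Qed.

Lemma normalizing_basis_conv (L G : pzRingType) (f : {rmorphism L -> G}) n (g : 'I_n -> G) :
  normalizing_basis f g -> normalizing_basis (conv_rmorphism f) (g : 'I_n -> G^c).
Proof.
case=> rgen rfree lgen lfree norm.
split; [exact: lgen|exact: lfree|exact: rgen|exact: rfree|].
by move=> i x; split=> [/(norm i x)|/(norm i x)].
Qed.

(** * Coordinates in a normalizing basis, and the induced module *)

Section Extension.
Variables (L G : pzRingType) (f : {rmorphism L -> G}) (n : nat) (g : 'I_n -> G).
Hypothesis nb : normalizing_basis f g.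

Lemma rcoef_ex : exists c : G -> 'I_n -> L, forall x, x = \sum_i g i * f (c x i).
Proof. by have [c cP] := choice (right_gen nb); exists c. Qed.
Definition rcoef := sval (cid rcoef_ex).
Lemma rcoefP x : x = \sum_i g i * f (rcoef x i).
Proof. exact: svalP (cid rcoef_ex) x. Qed.

Lemma rcoef_uniq x (a : 'I_n -> L) : x = \sum_i g i * f (a i) -> forall i, rcoef x i = a i.
Proof.
move=> xa i; apply/subr0_eq; apply: (right_free nb (a := fun i => rcoef x i - a i)) => //.
under eq_bigr do rewrite rmorphB mulrBr.
by rewrite sumrB -rcoefP -xa subrr.
Qed.

Lemma rcoefD x y i : rcoef (x + y) i = rcoef x i + rcoef y i.
Proof.
apply: (rcoef_uniq (a := fun i => rcoef x i + rcoef y i)).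
under eq_bigr do rewrite rmorphD mulrDr.
by rewrite big_split -!rcoefP.
Qed.

Lemma rcoef_mulr x a i : rcoef (x * f a) i = rcoef x i * a.
Proof.
apply: (rcoef_uniq (a := fun i => rcoef x i * a)).
under eq_bigr do rewrite rmorphM mulrA.
by rewrite -mulr_suml -rcoefP.
Qed.

(** In right coordinates, left multiplication by [x] has the matrix with entries
    [rcoef (x * g j) i]. This formula is what makes the induced action associative. *)
Lemma rcoefM x y i : rcoef (x * y) i = \sum_j rcoef (x * g j) i * rcoef y j.
Proof.
apply: (rcoef_uniq (a := fun i => \sum_j rcoef (x * g j) i * rcoef y j)).
under eq_bigr do rewrite rmorph_sum mulr_sumr.
rewrite exchange_big /= {1}(rcoefP y) mulr_sumr; apply: eq_bigr => j _.
under eq_bigr do rewrite rmorphM mulrA.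
by rewrite -mulr_suml -rcoefP mulrA.
Qed.

Lemma rcoef_basis (j i : 'I_n) a : rcoef (g j * f a) i = if i == j then a else 0.
Proof.
apply: (rcoef_uniq (a := fun i => if i == j then a else 0)).
rewrite (bigD1 j) //= eqxx big1 ?addr0 // => k /negbTE ->; by rewrite rmorph0 mulr0.
Qed.

Lemma lcoef_ex : exists c : G -> 'I_n -> L, forall x, x = \sum_i f (c x i) * g i.
Proof. by have [c cP] := choice (left_gen nb); exists c. Qed.
Definition lcoef := sval (cid lcoef_ex).
Lemma lcoefP x : x = \sum_i f (lcoef x i) * g i.
Proof. exact: svalP (cid lcoef_ex) x. Qed.

Lemma lcoef_uniq x (a : 'I_n -> L) : x = \sum_i f (a i) * g i -> forall i, lcoef x i = a i.
Proof.
move=> xa i; apply/subr0_eq; apply: (left_free nb (a := fun i => lcoef x i - a i)) => //.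
under eq_bigr do rewrite rmorphB mulrBl.
by rewrite sumrB -lcoefP -xa subrr.
Qed.

Lemma lcoef_linear a x y i : lcoef (f a * x + y) i = a * lcoef x i + lcoef y i.
Proof.
apply: (lcoef_uniq (a := fun i => a * lcoef x i + lcoef y i)).
under eq_bigr do rewrite rmorphD rmorphM mulrDl -mulrA.
by rewrite big_split -mulr_sumr -!lcoefP.
Qed.

Lemma lcoef_basis (j i : 'I_n) a : lcoef (f a * g j) i = if i == j then a else 0.
Proof.
apply: (lcoef_uniq (a := fun i => if i == j then a else 0)).
rewrite (bigD1 j) //= eqxx big1 ?addr0 // => k /negbTE ->; by rewrite rmorph0 mul0r.
Qed.

(** Coefficients at [g j] are unique on both sides, so the normalizing condition defines mutually
    inverse maps, and uniqueness forces them to be ring morphisms. *)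
Lemma basis_automorphism j : exists s t : {rmorphism L -> L},
  [/\ cancel s t, cancel t s & forall a, f a * g j = g j * f (s a)].
Proof.
have /choice[s sP] a : exists b, f a * g j = g j * f b.
  by apply/(normalizing nb); exists a.
have /choice[t tP] b : exists a, g j * f b = f a * g j.
  by apply/(normalizing nb); exists b.
have rinj a b : g j * f a = g j * f b -> a = b.
  by move=> /(congr1 (fun x => rcoef x j)); rewrite !rcoef_basis eqxx.
have linj a b : f a * g j = f b * g j -> a = b.
  by move=> /(congr1 (fun x => lcoef x j)); rewrite !lcoef_basis eqxx.
have sB : zmod_morphism s.
  by move=> a b; apply: rinj; rewrite -sP !rmorphB mulrBl mulrBr !sP.
have sM : monoid_morphism s.
  split=> [|a b]; apply: rinj; first by rewrite -sP !rmorph1 mul1r mulr1.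
  by rewrite -sP !rmorphM -mulrA sP mulrA sP -mulrA.
have tB : zmod_morphism t.
  by move=> a b; apply: linj; rewrite -tP !rmorphB mulrBl mulrBr !tP.
have tM : monoid_morphism t.
  split=> [|a b]; apply: linj; first by rewrite -tP !rmorph1 mul1r mulr1.
  by rewrite -tP !rmorphM mulrA tP -mulrA tP mulrA.
exists (make_rmorphism sB sM), (make_rmorphism tB tM).
by split=> // a; [apply: linj; rewrite -tP sP|apply: rinj; rewrite -sP tP].
Qed.

(* The induced module G (x)_L M, where (v_i)_i stands for the sum of the g_i (x) v_i. *)
Definition ind of normalizing_basis f g := fun M : lmodType L => {ffun 'I_n -> M}.

Section Induced.
Variable M : lmodType L.
Notation IM := (ind nb M).
HB.instance Definition _ := GRing.Zmodule.on IM.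

(** The product [x * g j] is expanded in right coordinates, and its coefficients are moved across
    the tensor sign onto [v j]. *)
Let scale (x : G) (v : IM) : IM := [ffun i => \sum_j rcoef (x * g j) i *: v j].
Let scaleA x y v : scale x (scale y v) = scale (x * y) v.
Proof.
apply/ffunP => i; rewrite !ffunE.
under eq_bigr do rewrite ffunE scaler_sumr.
rewrite exchange_big; apply: eq_bigr => k _ /=.
under eq_bigr do rewrite scalerA.
by rewrite -scaler_suml -mulrA rcoefM.
Qed.
Let scale1 : left_id 1 scale.
Proof.
move=> v; apply/ffunP => i; rewrite ffunE (bigD1 i) //= big1 => [|k /negbTE ki].
  by rewrite mul1r -[g i]mulr1 -[X in _ * X](rmorph1 f) rcoef_basis eqxx scale1r addr0.
by rewrite mul1r -[g k]mulr1 -[X in _ * X](rmorph1 f) rcoef_basis eq_sym ki scale0r.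
Qed.
Let scaleDr : right_distributive scale +%R.
Proof.
move=> x u v; apply/ffunP => i; rewrite !ffunE -big_split; apply: eq_bigr => j _.
by rewrite ffunE scalerDr.
Qed.
Let scaleDl v : {morph scale^~ v : x y / x + y}.
Proof.
move=> x y; apply/ffunP => i; rewrite !ffunE -big_split; apply: eq_bigr => j _.
by rewrite mulrDl rcoefD scalerDl.
Qed.
HB.instance Definition _ := GRing.Zmodule_isLmodule.Build G IM scaleA scale1 scaleDr scaleDl.

Lemma indZE x (v : IM) i : (x *: v) i = \sum_j rcoef (x * g j) i *: v j.
Proof. by rewrite ffunE. Qed.
Lemma indDE (u v : IM) i : (u + v) i = u i + v i.
Proof. by rewrite ffunE. Qed.
Lemma ind_sumE (I : Type) (r : seq I) (P : pred I) (F : I -> IM) i :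
  (\sum_(k <- r | P k) F k) i = \sum_(k <- r | P k) F k i.
Proof. by elim/big_rec2: _ => [|k u v _ <-]; rewrite ffunE. Qed.

Lemma indZE_twist (s : 'I_n -> L -> L) : (forall j a, f a * g j = g j * f (s j a)) ->
  forall a (v : IM) i, (f a *: v) i = s i a *: v i.
Proof.
move=> sP a v i; rewrite indZE (bigD1 i) //= sP rcoef_basis eqxx big1 ?addr0 // => k /negbTE ki.
by rewrite sP rcoef_basis eq_sym ki scale0r.
Qed.

Lemma ind_unit_proof (a : L) (x y : M) : [ffun i => rcoef 1 i *: (a *: x + y)] =
  a *: ([ffun i => rcoef 1 i *: x] : restr f IM) + ([ffun i => rcoef 1 i *: y] : restr f IM) :> restr f IM.
Proof.
apply/ffunP => i; rewrite restrZE [RHS]indDE indZE !ffunE scalerDr scalerA; congr (_ + _).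
under eq_bigr do rewrite ffunE scalerA.
by rewrite -scaler_suml -rcoefM mulr1 -{1}[f a]mul1r rcoef_mulr.
Qed.
(** The map sending [m] to 1 (x) m. The identity of [G] need not belong to the basis, whence its
    coordinates [rcoef 1 i]. *)
Definition ind_unit : {linear M -> restr f IM} :=
  make_linear (X := M) (Y := restr f IM) ind_unit_proof.

Lemma ind_unitE x i : ind_unit x i = rcoef 1 i *: x. Proof. by rewrite ffunE. Qed.

Lemma ind_decomp (v : IM) : v = \sum_j g j *: (ind_unit (v j) : IM).
Proof.
apply/ffunP => i; rewrite ind_sumE (eq_bigr (fun j => rcoef (g j) i *: v j)) => [|j _]; last first.
  rewrite indZE; under eq_bigr do rewrite ind_unitE scalerA.
  by rewrite -scaler_suml -rcoefM mulr1.
rewrite (bigD1 i) //= big1 => [|k /negbTE ki].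
  by rewrite -[g i]mulr1 -(rmorph1 f) rcoef_basis eqxx scale1r addr0.
by rewrite -[g k]mulr1 -(rmorph1 f) rcoef_basis eq_sym ki scale0r.
Qed.

Lemma ind_ext (Y : lmodType G) (h k : {linear IM -> Y}) :
  (forall x, h (ind_unit x) = k (ind_unit x)) -> h =1 k.
Proof.
move=> hk v; rewrite [v]ind_decomp !linear_sum; apply: eq_bigr => j _.
by rewrite !linearZ hk.
Qed.

Section Adjunction.
Variables (Y : lmodType G) (h : {linear M -> restr f Y}).
Lemma ind_adj_proof x (u v : IM) : \sum_j g j *: (h ((x *: u + v) j) : Y) =
  x *: (\sum_j g j *: (h (u j) : Y)) + \sum_j g j *: (h (v j) : Y).
Proof.
rewrite scaler_sumr.
have -> : \sum_j g j *: (h ((x *: u + v) j) : Y) =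
    \sum_j (\sum_k g j *: (f (rcoef (x * g k) j) *: (h (u k) : Y)) + g j *: (h (v j) : Y)).
  apply: eq_bigr => j _; rewrite indDE indZE linearD /= scalerDr; congr (_ + _).
  by rewrite linear_sum scaler_sumr; apply: eq_bigr => k _; rewrite linearZ.
rewrite big_split exchange_big; congr (_ + _); apply: eq_bigr => k _ /=.
under eq_bigr do rewrite scalerA.
by rewrite -scaler_suml -rcoefP scalerA.
Qed.
(** The transpose of [h], sending g_j (x) m to [g j *: h m]. *)
Definition ind_adj : {linear IM -> Y} := make_linear ind_adj_proof.

Lemma ind_adj_unit x : ind_adj (ind_unit x) = h x.
Proof.
rewrite /= (eq_bigr (fun j => (g j * f (rcoef 1 j)) *: (h x : Y))) => [|j _].
  by rewrite -scaler_suml -rcoefP scale1r.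
by rewrite ind_unitE linearZ -scalerA.
Qed.
End Adjunction.
End Induced.

Lemma ind_map_proof (X Y : lmodType L) (h : {linear X -> Y}) x (u v : ind nb X) :
  [ffun i => h ((x *: u + v) i)] = x *: ([ffun i => h (u i)] : ind nb Y) + ([ffun i => h (v i)] : ind nb Y)
  :> ind nb Y.
Proof.
apply/ffunP => i; rewrite indDE !indZE !ffunE linearD linear_sum; congr (_ + _).
by apply: eq_bigr => j _; rewrite ffunE linearZ.
Qed.
Definition ind_map (X Y : lmodType L) (h : {linear X -> Y}) : {linear ind nb X -> ind nb Y} :=
  make_linear (X := ind nb X) (Y := ind nb Y) (ind_map_proof h).

Lemma ind_mapE (X Y : lmodType L) (h : {linear X -> Y}) (v : ind nb X) i : ind_map h v i = h (v i).
Proof. by rewrite ffunE. Qed.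

Lemma ind_map_unit (X Y : lmodType L) (h : {linear X -> Y}) x :
  ind_map h (ind_unit X x) = ind_unit Y (h x).
Proof. by apply/ffunP => i; rewrite !ffunE linearZ. Qed.

Lemma ind_map_inj (X Y : lmodType L) (h : {linear X -> Y}) : injective h -> injective (ind_map h).
Proof.
by move=> hinj u v uv; apply/ffunP => i; apply: hinj; rewrite -!ind_mapE uv.
Qed.

Lemma ind_map_surj (X Y : lmodType L) (h : {linear X -> Y}) : surjective h -> surjective (ind_map h).
Proof.
move=> /choice[s sK] v; exists [ffun i => s (v i)].
by apply/ffunP => i; rewrite ind_mapE ffunE sK.
Qed.

Lemma ind_map_exact (X Y Z : lmodType L) (h : {linear X -> Y}) (k : {linear Y -> Z}) :
  exact_pair h k -> exact_pair (ind_map h) (ind_map k).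
Proof.
move=> ex v; split=> [v0|[u <-]]; last first.
  by apply/ffunP => i; rewrite !ind_mapE [RHS]ffunE; apply/ex; exists (u i).
have /choice[s sP] i : exists x, h x = v i by apply/ex; rewrite -ind_mapE v0 ffunE.
by exists [ffun i => s i]; apply/ffunP => i; rewrite ind_mapE ffunE.
Qed.

(** Induction is left adjoint to restriction, which preserves surjections. *)
Lemma ind_projective (P : lmodType L) : projective P -> projective (ind nb P).
Proof.
move=> projP X Y p h psurj.
have hlin a (x y : P) : h (ind_unit P (a *: x + y)) =
    a *: (h (ind_unit P x) : restr f Y) + (h (ind_unit P y) : restr f Y) :> restr f Y.
  rewrite (linearP (ind_unit P)); exact: (linearP h (f a)).
have [k kP] := projP _ _ (restr_map f p) (make_linear (Y := restr f Y) hlin) psurj.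
exists (ind_adj k) => v; apply: (ind_ext (h := p \o ind_adj k)) => x.
by apply: etrans (kP x); congr (p _); apply: ind_adj_unit.
Qed.

Lemma restr_injective (I : lmodType G) : injective_module I -> injective_module (restr f I).
Proof.
move=> injI X Y i h iinj.
have [k kP] := injI _ _ (ind_map i) (ind_adj h) (ind_map_inj iinj).
have klin a (x y : Y) : k (ind_unit Y (a *: x + y)) =
    a *: (k (ind_unit Y x) : restr f I) + (k (ind_unit Y y) : restr f I) :> restr f I.
  rewrite (linearP (ind_unit Y)); exact: (linearP k (f a)).
exists (make_linear (X := Y) (Y := restr f I) klin) => x /=.
by rewrite -[RHS]ind_adj_unit -kP ind_map_unit.
Qed.

(** Over [L] the [j]-th coordinate of the induced module is [M] twisted by [s]; restricting along
    [t] undoes the twist, so that [M] itself is a summand. *)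
Lemma ind_retract_twist j (s t : {rmorphism L -> L}) (M : lmodType L) :
  cancel t s -> (forall a, f a * g j = g j * f (s a)) ->
  retract M (restr t (restr f (ind nb M))).
Proof.
move=> st sP.
have inlin a (x y : M) : [ffun i => if i == j then a *: x + y else 0] =
    a *: ([ffun i => if i == j then x else 0] : restr t (restr f (ind nb M)))
    + ([ffun i => if i == j then y else 0] : restr t (restr f (ind nb M))) :> restr t (restr f (ind nb M)).
  apply/ffunP => i; rewrite [RHS]indDE indZE !ffunE.
  rewrite (bigD1 j) //= ffunE eqxx big1 ?addr0 => [|k /negbTE kj].
    rewrite sP st rcoef_basis; case: eqP => // _; by rewrite scale0r addr0.
  by rewrite ffunE kj scaler0.
have outlin a (u v : restr t (restr f (ind nb M))) : (a *: u + v : ind nb M) j =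
    a *: (u : ind nb M) j + (v : ind nb M) j.
  rewrite [LHS]indDE; congr (_ + _); change ((f (t a) *: (u : ind nb M)) j = a *: (u : ind nb M) j).
  rewrite indZE (bigD1 j) //= sP st rcoef_basis eqxx big1 ?addr0 // => k /negbTE kj.
  have [s' [t' [_ _ sk]]] := basis_automorphism k.
  by rewrite sk rcoef_basis eq_sym kj scale0r.
exists (make_linear (Y := restr t (restr f (ind nb M))) inlin).
exists (make_linear (X := restr t (restr f (ind nb M))) outlin) => m /=.
by rewrite ffunE eqxx.
Qed.

(** Each coordinate is a twist of [M], hence injective; the extensions found coordinate by
    coordinate are assembled. *)
Lemma ind_restr_injective (M : lmodType L) : injective_module M ->
  injective_module (restr f (ind nb M)).
Proof.
move=> injM X Y i h iinj.
(* The twist is only known to exist, so semilinearity of [k] is stated for every [s] that describes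
   the commutation with [g j]; such an [s] is unique. *)
have /choice[k kP] j : exists k : Y -> M, (forall x, k (i x) = (h x : ind nb M) j) /\
    forall s : {rmorphism L -> L}, (forall a, f a * g j = g j * f (s a)) ->
    forall a x y, k (a *: x + y) = s a *: k x + k y.
  have [s [t [st ts sP]]] := basis_automorphism j.
  have hlin a (x y : X) : (h (a *: x + y) : ind nb M) j =
      a *: ((h x : ind nb M) j : restr s M) + ((h y : ind nb M) j : restr s M) :> restr s M.
    rewrite (linearP h) [LHS]indDE; congr (_ + _).
    have /choice[s' s'P] j' : exists s' : L -> L, forall a, f a * g j' = g j' * f (s' a).
      by have [s' [t' [_ _ s'P]]] := basis_automorphism j'; exists s'.
    change ((f a *: (h x : ind nb M)) j = s a *: (h x : ind nb M) j); have <- : s' j a = s a.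
      have := s'P j a; rewrite sP => /(congr1 (fun x => rcoef x j)).
      by rewrite !rcoef_basis eqxx.
    exact: (indZE_twist s'P).
  have [k kP] := restr_aut_injective ts st injM (make_linear (X := X) (Y := restr s M) hlin) iinj.
  exists k; split=> [x|s' s'P a x y]; first exact: kP.
  have -> : s' a = s a.
    have := s'P a; rewrite sP => /(congr1 (fun x => rcoef x j)).
    by rewrite !rcoef_basis eqxx.
  exact: (linearP k).
have klin a (x y : Y) : [ffun j => k j (a *: x + y)] =
    a *: ([ffun j => k j x] : restr f (ind nb M)) + ([ffun j => k j y] : restr f (ind nb M))
    :> restr f (ind nb M).
  apply/ffunP => j; rewrite [RHS]indDE [LHS]ffunE [X in _ = _ + X]ffunE.
  have /choice[s sP] j' : exists s : {rmorphism L -> L}, forall a, f a * g j' = g j' * f (s a).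
    by have [s' [t' [_ _ s'P]]] := basis_automorphism j'; exists s'.
  rewrite ((kP j).2 (s j) (sP j)); congr (_ + _).
  have := indZE_twist sP a ([ffun j => k j x] : ind nb M) j.
  by rewrite [X in _ = _ *: X]ffunE => <-.
exists (make_linear (Y := restr f (ind nb M)) klin) => x.
by apply/ffunP => j; rewrite ffunE (kP j).1.
Qed.

Lemma ind_pd_le m (M : lmodType L) : pd_le m M -> pd_le m (ind nb M).
Proof.
elim: m M => [|m IHm] M; first exact: ind_projective.
case=> [P [K [i [p [projP iinj ex psurj /IHm pdK]]]]].
exists (ind nb P), (ind nb K), (ind_map i), (ind_map p); split=> //.
- exact: ind_projective.
- exact: ind_map_inj.
- exact: ind_map_exact.
- exact: ind_map_surj.
Qed.

End Extension.

(** * Relative projectivity and purity *)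

(** Stated for left modules over any extension; taken at [conv_rmorphism f] it is the splitting
    condition on right modules. *)
Definition relatively_projective (L G : pzRingType) (f : {rmorphism L -> G}) :=
  forall (M : lmodType G) (N : {pred M}), submod_closed N ->
    direct_summand (N : {pred restr f M}) -> direct_summand N.

Definition relatively_injective (L G : pzRingType) (f : {rmorphism L -> G}) :=
  forall I : lmodType G, injective_module (restr f I) -> injective_module I.

(** * Coinduced modules *)

Section Coinduced.
Variables (L G : pzRingType) (f : {rmorphism L -> G}).

Definition left_linear (X : lmodType L) (phi : G -> X) :=
  forall a x y, phi (f a * x + y) = a *: phi x + phi y.

Lemma coind_spec (X : lmodType L) : hom_spec (@GRing.mul G) (@left_linear X).
Proof.
split=> [x|x a b|x a b|phi phiP x y|a x y|phi psi phiP psiP a x y|phi b phiP a x y].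
- exact: mulr1.
- exact: mulrA.
- exact: mulrDr.
- by have := phiP 1 x y; rewrite rmorph1 mul1r scale1r.
- by rewrite scaler0 addr0.
- by rewrite phiP psiP opprD addrACA scalerBr.
- by rewrite mulrDl -mulrA phiP.
Qed.

(** Hom_L(G, X), the right adjoint of restriction; [coind_adj] is the transpose and [coind_eval],
    evaluation at 1, the counit. *)
Definition coind (X : lmodType L) : lmodType G := hom (coind_spec X).

Lemma coindP X (phi : coind X) : left_linear phi. Proof. exact: homP phi. Qed.

Section Adjunction.
Variables (Y : lmodType G) (X : lmodType L) (h : {linear restr f Y -> X}).
Lemma coind_adj_linear (y : Y) : left_linear (fun x => h (x *: y)).
Proof. by move=> a u v; rewrite scalerDl -scalerA; apply: (linearP h). Qed.
Lemma coind_adj_proof (a : G) (x y : Y) : Hom (coind_spec X) (coind_adj_linear (a *: x + y)) =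
  a *: (Hom (coind_spec X) (coind_adj_linear x) : coind X) + Hom (coind_spec X) (coind_adj_linear y).
Proof.
apply: hom_ext => u; rewrite homDE homZE /= scalerDr scalerA.
exact: (linearD h).
Qed.
Definition coind_adj : {linear Y -> coind X} := make_linear (Y := coind X) coind_adj_proof.
Lemma coind_adjE y x : coind_adj y x = h (x *: y). Proof. by []. Qed.
End Adjunction.

Lemma coind_eval_proof X (a : L) (phi psi : restr f (coind X)) :
  (a *: phi + psi : coind X) 1 = a *: (phi : coind X) 1 + (psi : coind X) 1.
Proof.
rewrite homDE; congr (_ + _); change ((phi : coind X) (1 * f a) = a *: (phi : coind X) 1).
have := coindP phi a 1 0; rewrite mulr1 mul1r !addr0 => ->.
have := coindP phi (-1) 0 0; rewrite mulr0 addr0 scaleN1r addNr => ->.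
by rewrite addr0.
Qed.
Definition coind_eval X : {linear restr f (coind X) -> X} :=
  make_linear (X := restr f (coind X)) (@coind_eval_proof X).

Lemma coind_injective X : injective_module X -> injective_module (coind X).
Proof.
move=> injX M N i h iinj.
have [k kP] := injX _ _ (restr_map f i) (coind_eval X \o restr_map f h : {linear restr f M -> X}) iinj.
exists (coind_adj k) => m; apply: hom_ext => x.
rewrite coind_adjE -linearZ; apply: etrans (kP (x *: m)) _.
change (h (x *: m) 1 = h m x); by rewrite linearZ homZE mul1r.
Qed.

Definition coind_unit (M : lmodType G) : {linear M -> coind (restr f M)} :=
  coind_adj (idfun : {linear restr f M -> restr f M}).

Lemma coind_unitK (M : lmodType G) (m : M) : coind_eval (restr f M) (coind_unit M m) = m.
Proof. exact: (@scale1r G M m). Qed.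

Lemma coind_unit_inj (M : lmodType G) : injective (coind_unit M).
Proof. by move=> x y xy; rewrite -[x]coind_unitK xy coind_unitK. Qed.

Section Basis.
Variables (n : nat) (g : 'I_n -> G).
Hypothesis nb : normalizing_basis f g.

Lemma restr_projective (P : lmodType G) : projective P -> projective (restr f P).
Proof.
move=> projP X Y p h /choice[s sK].
have compl (phi : coind X) : left_linear (fun x => p (phi x)).
  by move=> b x y; rewrite (coindP phi) linearP.
have qlin (a : G) (phi psi : coind X) : Hom (coind_spec Y) (compl (a *: phi + psi)) =
    a *: (Hom (coind_spec Y) (compl phi) : coind Y) + Hom (coind_spec Y) (compl psi).
  apply: hom_ext => x; rewrite [RHS]homDE.
  change (p ((a *: phi + psi) x) = p (phi (x * a)) + p (psi x)).
  by rewrite homDE linearD.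
have [|k kP] := projP _ _ (make_linear (X := coind X) (Y := coind Y) qlin) (coind_adj h).
  move=> phi.
  (* Coinduction preserves surjections because [G] is left free: the values of [phi] at the basis
     elements are lifted through [p] and extended linearly. *)
  have philin : left_linear (fun x => \sum_i lcoef nb x i *: s ((phi : coind Y) (g i))).
    move=> a x y; rewrite scaler_sumr -big_split; apply: eq_bigr => i _ /=.
    by rewrite lcoef_linear scalerDl scalerA.
  exists (Hom (coind_spec X) philin); apply: hom_ext => x /=.
  rewrite linear_sum {2}(lcoefP nb x).
  have phi0 : (phi : coind Y) 0 = 0.
    by have := coindP phi (-1) 0 0; rewrite mulr0 addr0 scaleN1r addNr.
  rewrite (big_morph phi (hom_additive (coind_spec Y) (coindP phi)) phi0).
  apply: eq_bigr => i _; rewrite linearZ /= sK.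
  by have := coindP phi (lcoef nb x i) (g i) 0; rewrite !addr0 phi0 addr0.
have klin (a : L) (x y : restr f P) : k (a *: x + y) 1 = a *: k x 1 + k y 1.
  exact: (linearP (coind_eval X \o restr_map f k)).
exists (make_linear (X := restr f P) klin) => x /=.
have /(congr1 (fun phi : coind Y => phi 1)) := kP x.
by rewrite coind_adjE scale1r.
Qed.
End Basis.

Lemma summand_retract (M N : lmodType G) (i : {linear N -> M}) : injective i ->
  direct_summand (fun m => `[< exists x, i x = m >]) -> retract N M.
Proof.
move=> iinj [_ [K [Ks MK IK]]]; have Ksub := submod_closedP Ks.
have /choice[r rP] m : exists x, m - i x \in K.
  have [_ [k [/asboolW[x <-] kK ->]]] := MK m; by exists x; rewrite addrC addKr.
have runiq m x : m - i x \in K -> r m = x.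
  move=> mx; apply/iinj/subr0_eq/IK.
    by apply/asboolT; exists (r m - x); rewrite linearB.
  by have := submodB Ksub mx (rP m); rewrite opprB addrC addrA subrK.
have rlin a x y : r (a *: x + y) = a *: r x + r y.
  apply: runiq; rewrite linearP opprD addrACA -scalerBr.
  exact: (submodP Ksub a (rP x) (rP y)).
exists i, (make_linear rlin) => m /=; apply: runiq.
by rewrite subrr; apply: submod0 Ksub.
Qed.

(** [I] embeds in the injective module [coind (restr f I)], and evaluation at 1 splits the embedding
    over [L]; relative projectivity turns this into a splitting over [G]. *)
Lemma relatively_projective_injective : relatively_projective f -> relatively_injective f.
Proof.
move=> relproj I injI.
suff : retract I (coind (restr f I)).
  by move=> /retract_injective; apply; apply: coind_injective.
apply: (summand_retract (@coind_unit_inj I)).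
pose im (phi : coind (restr f I)) := `[< exists x, coind_unit I x = phi >].
have ims : submod_closed (im : {pred _}) := submodule_pred (submod_im (coind_unit I)).
apply: (relproj _ im) => //; split.
  exact: (submodule_pred (submod_im (restr_map f (coind_unit I)))).
exists (fun phi => `[< coind_eval (restr f I) phi = 0 >]); split.
- exact: (submodule_pred (submod_ker (coind_eval (restr f I)))).
- move=> phi; exists (restr_map f (coind_unit I) (coind_eval _ phi)).
  exists (phi - restr_map f (coind_unit I) (coind_eval _ phi)); split.
  + by apply/asboolT; exists (coind_eval _ phi).
  + by apply/asboolT; rewrite linearB [X in _ - X]coind_unitK subrr.
  + by rewrite addrC subrK.
- move=> phi /asboolW[x <-] /asboolW; rewrite coind_unitK => ->; exact: linear0.
Qed.

End Coinduced.

Lemma subgroup_submodule (V : zmodType) (S : V -> Prop) : S 0 ->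
  (forall x y, S x -> S y -> S (x - y)) -> submodule (S : zmodule V -> Prop).
Proof.
move=> S0 SB; have SN x : S x -> S (- x) by rewrite -sub0r; apply: SB.
have SD x y : S x -> S y -> S (x + y) by move=> Sx /SN; rewrite -{2}[y]opprK; apply: SB.
have Sn x k : S x -> S (x *+ k).
  by move=> Sx; elim: k => [|k Sk]; rewrite ?mulr0n // mulrS; apply: SD.
split=> // a x y Sx Sy; apply: SD => //; rewrite scalezrE.
by case: (intP a) => [|k|k]; rewrite ?mulrNz -?pmulrn ?mulr0z //; [apply: Sn|apply/SN/Sn].
Qed.

(** * Character modules and purity of split inclusions *)

Section Purity.
Variables (L G : pzRingType) (f : {rmorphism L -> G}).
Hypothesis relproj : relatively_projective (conv_rmorphism f).

Lemma dual_spec (X : lmodType G) : @hom_spec G^c X rat_mod_int (fun x a => (a : G) *: x)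
  (fun chi => forall x y, chi (x + y) = chi x + chi y).
Proof.
split=> [x|x a b|x a b|//|x y|phi psi phiP psiP x y|phi a phiP x y].
- exact: scale1r.
- by rewrite scalerA.
- exact: scalerDl.
- by rewrite addr0.
- by rewrite phiP psiP opprD addrACA.
- by rewrite scalerDr phiP.
Qed.

Definition dual (X : lmodType G) : rmodType G := hom (dual_spec X).

Lemma dualD X (chi : dual X) x y : chi (x + y) = chi x + chi y.
Proof. exact: (homP chi). Qed.
Lemma dual0 X (chi : dual X) : chi 0 = 0.
Proof. by apply: (addIr (chi 0)); rewrite -dualD !add0r. Qed.
Lemma dual_sum X (chi : dual X) (I : Type) (r : seq I) (P : pred I) (F : I -> X) :
  chi (\sum_(i <- r | P i) F i) = \sum_(i <- r | P i) chi (F i).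
Proof. exact: (big_morph chi (dualD chi) (dual0 chi)). Qed.

(* Relative projectivity of the dual module yields a G-submodule of characters of M that
   restricts isomorphically onto the characters of N. *)
Lemma dual_extension (N M : lmodType G) (i : {linear N -> M})
    (r : {linear restr f M -> restr f N}) : (forall x, r (i x) = x) ->
  exists K : dual M -> Prop, [/\ submodule K,
    forall psi, K psi -> (forall x, psi (i x) = 0) -> psi = 0
    & forall chi : dual N, exists2 psi, K psi & forall x, psi (i x) = chi x].
Proof.
move=> ri.
pose Z (psi : dual M) := forall x, psi (i x) = 0.
have Zs : submodule Z.
  split=> // a u v Zu Zv x; rewrite homDE homZE -linearZ Zu Zv; exact: addr0.
have pullD (chi : dual N) x y : chi (r (x + y)) = chi (r x) + chi (r y).
  by rewrite (linearD r) [LHS]dualD.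
pose pull (chi : dual N) : dual M := Hom (dual_spec M) (pullD chi).
have resD (psi : dual M) x y : psi (i (x + y)) = psi (i x) + psi (i y).
  by rewrite linearD dualD.
pose res psi : dual N := Hom (dual_spec N) (resD psi).
have [|_ [K [Ks MK ZK]]] := relproj (N := fun psi => `[< Z psi >]) (submodule_pred Zs).
  split; first exact: (submodule_pred (submodule_restr (conv_rmorphism f) Zs)).
  (* Restricting to [N] and pulling back along [r] is an idempotent [L]-linear map with kernel [Z],
     so its fixed points form an [L]-complement of [Z]. *)
  exists (fun psi => `[< pull (res psi) = psi >]); split.
  - split=> [|a u v /asboolW uE /asboolW vE]; apply/asboolT/hom_ext => m /=.
      by [].
    have uir x : u (i (r x)) = u x by rewrite -{2}uE.
    have vir x : v (i (r x)) = v x by rewrite -{2}vE.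
    change ((((f a : G^c) *: (u : dual M) + v) : dual M) (i (r m)) =
      (((f a : G^c) *: (u : dual M) + v) : dual M) m).
    rewrite !homDE !homZE vir -(uir (_ *: m)); congr (u _ + _).
    by rewrite -linearZ; congr (i _); apply/esym; apply: (linearZZ r a m).
  - move=> psi; exists (psi - pull (res psi)), (pull (res psi)).
    have resE x : res psi x = psi (i x) by [].
    have subE (u v : dual M) x : (u - v) x = u x - v x.
      by rewrite homDE; congr (_ + _); apply: (addIr (v x)); rewrite -homDE !addNr.
    split; last by rewrite subrK.
      by apply/asboolT => x; rewrite [LHS]subE /= ri subrr.
    by apply/asboolT/hom_ext => m /=; rewrite ri.
  - move=> psi /asboolW Zpsi /asboolW <-; apply: hom_ext => m; exact: Zpsi.
exists (fun psi => psi \in K); split; first exact: submod_closedP.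
  by move=> psi Kpsi Zpsi; apply: ZK => //; apply: asboolT.
move=> chi; have [z [k [/asboolW Zz Kk pullE]]] := MK (pull chi); exists k => // x.
have := congr1 (fun psi : dual M => psi (i x)) pullE.
by rewrite homDE Zz add0r /= ri.
Qed.

(** Otherwise a character [chi] of the [p]-tuples over [N] kills every right-hand side solvable in
    [N] but not [c]. Its components extend to characters [psi k] of [M] taken in [K], and evaluating
    these at the solution [y] gives [chi c = 0]. *)
Lemma split_pure (N M : lmodType G) (i : {linear N -> M})
    (r : {linear restr f M -> restr f N}) (p q : nat) (a : 'I_p -> 'I_q -> G)
    (c : 'I_p -> N) (y : 'I_q -> M) : (forall x, r (i x) = x) ->
  (forall k, \sum_j a k j *: y j = i (c k)) ->
  exists z : 'I_q -> N, forall k, \sum_j a k j *: z j = c k.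
Proof.
move=> ri yP.
pose B : lmodType int := zmodule {ffun 'I_p -> N}.
pose S (v : B) := exists z : 'I_q -> N, forall k, \sum_j a k j *: z j = (v : {ffun 'I_p -> N}) k.
have Ss : submodule S.
  apply: subgroup_submodule => [|u v [z zP] [w wP]].
    by exists (fun=> 0) => k; rewrite ffunE big1 // => j _; rewrite scaler0.
  exists (fun j => z j - w j) => k.
  under eq_bigr do rewrite scalerBr.
  by rewrite sumrB zP wP !ffunE.
apply: contrapT => nS.
have [|chi [chiS chic]] := @character_separation B S [ffun k => c k] Ss.
  by move=> [z zP]; apply: nS; exists z => k; rewrite zP ffunE.
have [K [Ks K0 Kext]] := dual_extension ri.
pose inc k (x : N) : B := [ffun l => if l == k then x else 0].
have chiD k u v : chi (inc k (u + v)) = chi (inc k u) + chi (inc k v).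
  rewrite -linearD; congr (chi _); apply/ffunP => l; rewrite !ffunE.
  by case: eqP; rewrite ?addr0.
have chiE (v : B) : chi v = \sum_k chi (inc k ((v : {ffun 'I_p -> N}) k)).
  rewrite -linear_sum; congr (chi _); apply/ffunP => l; rewrite sum_ffunE.
  rewrite (bigD1 l) //= ffunE eqxx big1 ?addr0 // => k /negbTE kl.
  by rewrite ffunE eq_sym kl.
have /choice[psi psiP] k : exists psi, K psi /\ forall x, psi (i x) = chi (inc k x).
  by have [psi Kpsi psiE] := Kext (Hom (dual_spec N) (chiD k)); exists psi.
apply: chic; rewrite chiE.
transitivity (\sum_j (\sum_k (a k j : G^c) *: psi k) (y j)).
  rewrite [RHS](eq_bigr (fun j => \sum_k psi k (a k j *: y j))); last first.
    by move=> j _; rewrite hom_sumE.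
  rewrite exchange_big; apply: eq_bigr => k _.
  by rewrite -dual_sum yP (psiP k).2 ffunE.
(* This combination lies in [K] and vanishes on [N]: its value at [x] is [chi] of the right-hand
   side solved by placing [x] in position [j] and 0 elsewhere. Hence it vanishes on all of [M]. *)
apply: big1 => j _; rewrite (K0 (\sum_k (a k j : G^c) *: psi k)) ?hom0E //.
  by apply: (submod_sum Ks) => k _; apply: (submodZ Ks); case: (psiP k).
move=> x; rewrite hom_sumE -[RHS](chiS [ffun k => a k j *: x]).
  rewrite chiE; apply: eq_bigr => k _.
  by rewrite homZE -linearZ (psiP k).2 ffunE.
exists (fun l => if l == j then x else 0) => k.
rewrite ffunE (bigD1 j) //= eqxx big1 ?addr0 // => l /negbTE lj.
by rewrite lj scaler0.
Qed.
End Purity.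

Lemma in_span_nth_min (A : pzRingType) (M : lmodType A) (S : M -> Prop) (s : seq M) :
  submodule S -> (forall k : 'I_(size s), S s`_k) -> forall m, in_span s m -> S m.
Proof.
move=> Ss sS; apply: in_span_min => // x xs.
rewrite -(nth_index 0 xs); rewrite -index_mem in xs; exact: (sS (Ordinal xs)).
Qed.

(** * Consequences of purity over a left noetherian extension *)

Section LeftExtension.
Variables (L G : pzRingType) (f : {rmorphism L -> G}) (n : nat) (g : 'I_n -> G).
Hypothesis nb : normalizing_basis f g.
Hypothesis relproj : relatively_projective (conv_rmorphism f).
Hypothesis noeth : noetherian G^o.

(** A map from a left ideal to [I] extends to [G] with values in the injective module [M]. The ideal
    is finitely generated, so purity of [I] in [M] replaces the value at 1 by an element of [I]. *)
Lemma left_relatively_injective : relatively_injective f.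
Proof.
move=> I injI; apply: baer_injective => H Hs H0.
pose M := coind f (restr f I).
have injM : injective_module M by apply: coind_injective.
pose H' (z : (G^o * M)%type) := exists2 j, H (z.1, j) & coind_unit f I j = z.2.
have H's : submodule H'.
  split=> [|x u v [j Hj jE] [k Hk kE]]; first by exists 0; [exact: submod0 Hs|exact: linear0].
  by exists (x *: j + k); [exact: (submodP Hs x Hj Hk)|rewrite linearP jE kE].
have [|h hP] := injective_graph injM H's.
  by move=> m [j /H0 -> mE]; rewrite -[LHS]mE linear0.
have [s [sH Hsp]] : fin_gen (fun x => exists j, H (x, j)).
  apply: noeth; split=> [|x u v [j Hj] [k Hk]]; first by exists 0; apply: submod0 Hs.
  by exists (x *: j + k); exact: (submodP Hs x Hj Hk).
have /choice[c cP] (k : 'I_(size s)) : exists j, H (s`_k, j) by apply/sH/mem_nth.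
(* One unknown, and one equation for each generator of the ideal; [h 1] is the solution in [M]. *)
have [||z zP] := split_pure relproj (i := coind_unit f I) (r := coind_eval f (restr f I))
    (a := fun k (_ : 'I_1) => s`_k) (c := c) (y := fun=> h 1).
- exact: coind_unitK.
- move=> k; rewrite big_ord1 -linearZ -(hP s`_k (coind_unit f I (c k))); last by exists (c k); [exact: cP|].
  by congr (h _); apply: mulr1.
exists (z 0) => x j Hxj.
have Huniq y u v : H (y, u) -> H (y, v) -> u = v.
  move=> Hu Hv; apply/subr0_eq/H0; have := submodB Hs Hu Hv.
  by rewrite (_ : _ - _ = (0, u - v)) //; congr pair; apply: subrr.
apply: (Huniq _ _ _ _ Hxj); apply: (@in_span_nth_min _ G^o (fun x => H (x, (x : G) *: z 0)) s).
- split=> [|a u v Hu Hv]; first by rewrite scale0r; apply: submod0 Hs.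
  by rewrite scalerDl -scalerA; exact: (submodP Hs a Hu Hv).
- by move=> k; have := zP k; rewrite big_ord1 => ->.
- by apply: Hsp; exists j.
Qed.

Lemma ffun_finitely_generated (A : pzRingType) q : finitely_generated ({ffun 'I_q -> A^o} : lmodType A).
Proof.
exists q, (fun j => [ffun k => (k == j)%:R]) => a; exists (fun j => a j); apply/ffunP => k.
rewrite sum_ffunE (bigD1 k) //= big1 => [|j /negbTE kj]; rewrite !ffunE /=.
  by rewrite eqxx addr0 [RHS]mulr1.
by rewrite eq_sym kj; apply: mulr0.
Qed.

(** The map [e] from the induced module onto [M] is split over [L] by the unit, so its kernel [N] is
    pure. Lifting the generators of [M] by the unit satisfies their relations only modulo [N];
    finitely many relations suffice, and purity corrects the lifts. *)
Lemma ind_retract (M : lmodType G) : finitely_generated M -> retract M (ind nb (restr f M)).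
Proof.
case=> q [x xgen]; pose I : lmodType G := ind nb (restr f M).
pose e : {linear I -> M} := ind_adj nb (idfun : {linear restr f M -> restr f M}).
pose u : {linear restr f M -> restr f I} := ind_unit nb (restr f M).
have eu m : e (u m) = m by exact: (ind_adj_unit nb (idfun : {linear restr f M -> restr f M}) m).
pose N := submod (submod_ker e).
have rP (v : I) : e (v - u (e v)) = 0 by rewrite linearB eu subrr.
have rlin (a : L) (v w : restr f I) : Submod (submod_ker e) (rP (a *: v + w)) =
    a *: (Submod (submod_ker e) (rP v) : restr f N) + Submod (submod_ker e) (rP w).
  apply: submod_val_inj; change ((a *: v + w) - u (restr_map f e (a *: v + w)) =
    a *: (v - u (restr_map f e v)) + (w - u (restr_map f e w))).
  by rewrite !(linearP (restr_map f e), linearP u) opprD addrACA scalerBr.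
pose r : {linear restr f I -> restr f N} := make_linear (X := restr f I) (Y := restr f N) rlin.
pose rel (b : {ffun 'I_q -> G^o}) := \sum_j (b j : G) *: x j = 0.
have comblin (Y : lmodType G) (y : 'I_q -> Y) a (b c : {ffun 'I_q -> G^o}) :
    \sum_j ((a *: b + c) j : G) *: y j = a *: (\sum_j (b j : G) *: y j) + \sum_j (c j : G) *: y j.
  rewrite scaler_sumr -big_split; apply: eq_bigr => j _ /=.
  by rewrite !ffunE scalerDl scalerA.
pose comb (Y : lmodType G) (y : 'I_q -> Y) : {linear {ffun 'I_q -> G^o} -> Y} :=
  make_linear (comblin Y y).
have [s [sR Rs]] := noetherian_fg noeth (ffun_finitely_generated G q) (submod_ker (comb M x)).
have cP (k : 'I_(size s)) : e (\sum_j (s`_k j : G) *: (u (x j) : I)) = 0.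
  rewrite linear_sum; under eq_bigr do rewrite linearZ eu.
  by apply: sR; apply: mem_nth.
have [||z zP] := split_pure relproj (i := submod_incl (submod_ker e)) (r := r)
  (a := fun k j => s`_k j) (c := fun k : 'I_(size s) => Submod (submod_ker e) (cP k)) (y := fun j => u (x j)).
- case=> v ev; apply: submod_val_inj; change (v - u (e v) = v).
  by rewrite ev (linear0 u) subr0.
- by [].
(* The corrected lifts: they satisfy all relations between the generators, hence define a section of
   [e]. *)
pose w j : I := (u (x j) : I) - submod_incl _ (z j).
have [||k kP] := linear_factor (p := comb M x) (t := comb I w).
- by move=> m; have [b ->] := xgen m; exists [ffun j => b j]; apply: eq_bigr => j _; rewrite ffunE.
- move=> b /Rs; apply: (in_span_nth_min (submod_ker (comb I w))) => i.
  rewrite /= /w; under eq_bigr do rewrite scalerBr -linearZ.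
  by rewrite sumrB -linear_sum zP /= subrr.
exists k, e => m; have [b ->] := xgen m.
pose c : {ffun 'I_q -> G^o} := [ffun j => b j].
have -> : \sum_j b j *: x j = comb M x c by apply: eq_bigr => j _; rewrite ffunE.
rewrite kP; change (e (\sum_j (c j : G) *: w j) = \sum_j (c j : G) *: x j).
rewrite linear_sum; apply: eq_bigr => j _.
by rewrite linearZ linearB eu [X in _ - X](submod_valP (z j)) subr0.
Qed.
End LeftExtension.

(** * Minimal injective resolutions *)

Section MinimalResolutions.
Variable A : pzRingType.
Implicit Types I J M X Y : lmodType A.

(* E is a maximal essential extension of X in J, and N a maximal submodule containing X'
   and meeting E trivially. *)
Lemma injective_split J (X X' : J -> Prop) : injective_module J ->
  submodule X -> submodule X' -> (forall z, X z -> X' z -> z = 0) ->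
  exists E N : J -> Prop,
    [/\ [/\ submodule E, submodule N, forall z, X z -> E z & forall z, X' z -> N z],
        forall z, E z -> N z -> z = 0, forall z, exists e n, [/\ E e, N n & z = e + n]
      & forall y, E y -> y <> 0 -> exists2 a, X (a *: y) & a *: y <> 0].
Proof.
move=> injJ Xs X's XX'.
pose ess y := y <> 0 -> exists2 a, X (a *: y) & a *: y <> 0.
have [|E [Es XE Eess Emax]] := @maximal_submodule _ _ ess _ Xs.
  by move=> x Xx x0; exists 1; rewrite scale1r.
have [|N [Ns X'N NE Nmax]] := @maximal_submodule _ _ (fun z => E z -> z = 0) _ X's.
  move=> z X'z Ez; apply: contrapT => z0; have [a Xaz] := Eess z Ez z0; apply.
  by apply: XX' Xaz _; apply: submodZ.
pose H (w : (J * J)%type) := exists e n, [/\ E e, N n & w = (e + n, e)].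
have Hs : submodule H.
  split=> [|a _ _ [e [m [Ee Nm ->]]] [e' [m' [Ee' Nm' ->]]]].
    by exists 0, 0; rewrite addr0; split=> //; apply: submod0.
  exists (a *: e + e'), (a *: m + m'); split; [exact: (submodP Es)|exact: (submodP Ns)|].
  by congr pair; rewrite /= scalerDr addrACA.
(* [phi] extends the projection of [E + N] onto [E] to all of [J]; the two maximality properties
   determine its kernel and its image. *)
have [|phi phiP] := injective_graph injJ Hs.
  move=> _ [e [m [Ee Nm [/eqP + ->]]]]; rewrite eq_sym addr_eq0 => /eqP eE.
  by apply: NE => //; rewrite eE -scaleN1r; apply: submodZ.
have phiE e : E e -> phi e = e.
  by move=> Ee; apply: phiP; exists e, 0; rewrite addr0; split=> //; apply: submod0.
have phiN m : N m -> phi m = 0.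
  by move=> Nm; apply: phiP; exists 0, m; rewrite add0r; split=> //; apply: submod0.
have kerN z : phi z = 0 -> N z.
  apply: (Nmax (fun z => phi z = 0)) => //; first exact: submod_ker.
  by move=> y phiy /phiE <-.
(* The image of [phi] is still essential over [X]: if [phi z] is non-zero, then [N] together with
   the multiples of [z] meets [E] in some non-zero [w], and [w] is a multiple of [phi z]. *)
have imE y : E (phi y).
  apply: (Emax (fun z => exists y, phi y = z)); [exact: submod_im| | |by exists y].
    by move=> e Ee; exists e; apply: phiE.
  move=> _ [z <-] phiz; pose N' w := exists u v, [/\ N u, exists a, v = a *: z & w = u + v].
  have [w [N'w Ew w0]] : exists w, [/\ N' w, E w & w <> 0].
    apply: contrapT => nw; apply: phiz; apply: phiN; apply: (Nmax N').
    - exact: submod_add Ns (submod_cyclic z).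
    - by move=> u Nu; exists u, 0; rewrite addr0; split=> //; exists 0; rewrite scale0r.
    - by move=> w N'w Ew; apply: contrapT => w0; apply: nw; exists w.
    - exists 0, z; rewrite add0r; split=> //; first exact: submod0.
      by exists 1; rewrite scale1r.
  have [b Xbw bw0] := Eess w Ew w0; case: N'w => u [_ [Nu [a ->] wE]].
  have phiw : w = a *: phi z by rewrite -[LHS]phiE // wE linearD phiN // add0r linearZ.
  by exists (b * a); rewrite -scalerA -phiw.
exists E, N; split=> // [z Ez Nz|z]; first exact: NE.
exists (phi z), (z - phi z); split=> //.
  by apply: kerN; rewrite linearB (phiE _ (imE z)) subrr.
by rewrite addrC subrK.
Qed.

(** In each degree [injective_split] extends a splitting of the kernel of [d i] to a splitting of
    [J i], and [d i] maps the two halves onto a splitting of the next kernel. The halves that are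
    essential over the part coming from [M] form the resolution. *)
Lemma minimal_resolution_retract M X (J : nat -> lmodType A) (e : {linear X -> J 0})
    (d : forall i, {linear J i -> J i.+1}) :
  retract M X -> injective_resolution e d ->
  exists (I : nat -> lmodType A) (e' : {linear M -> I 0}) (d' : forall i, {linear I i -> I i.+1}),
    minimal_injective_resolution e' d' /\ forall i, retract (I i) (J i).
Proof.
case=> s [r rs] [injJ einj ex0 exS].
(* The state of the recursion: the kernel of [d i] is the direct sum of [XX.1], which comes from
   [M], and [XX.2], which is to be discarded. *)
pose good i (XX : (J i -> Prop) * (J i -> Prop)) := [/\ submodule XX.1, submodule XX.2,
  forall z, XX.1 z -> XX.2 z -> z = 0
  & forall z, d i z = 0 <-> exists x x', [/\ XX.1 x, XX.2 x' & z = x + x']].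
pose splits i (XX EN : (J i -> Prop) * (J i -> Prop)) :=
    [/\ [/\ submodule EN.1, submodule EN.2, forall z, XX.1 z -> EN.1 z & forall z, XX.2 z -> EN.2 z],
        forall z, EN.1 z -> EN.2 z -> z = 0,
        forall z, exists e n, [/\ EN.1 e, EN.2 n & z = e + n]
      & forall y, EN.1 y -> y <> 0 -> exists2 a, XX.1 (a *: y) & a *: y <> 0].
have split_ex i (XX : {XX | @good i XX}) : exists EN, splits i (sval XX) EN.
  have [X1s X2s X12 _] := svalP XX.
  by have [E [N EN]] := injective_split (injJ i) X1s X2s X12; exists (E, N).
pose EN i XX := sval (cid (split_ex i XX)).
have ENP i XX : splits i (sval XX) (EN i XX) := svalP (cid (split_ex i XX)).
pose next i (XX : {XX | @good i XX}) : (J i.+1 -> Prop) * (J i.+1 -> Prop) :=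
  (fun y => exists2 x, (EN i XX).1 x & d i x = y, fun y => exists2 x, (EN i XX).2 x & d i x = y).
(* As [E] and [N] are independent, an element of the kernel has the same decomposition along them as
   along the two parts of the kernel. Hence the images of [E] and [N] under [d i] are independent
   too. *)
have ker_split i (XX : {XX | @good i XX}) z w : (EN i XX).1 z -> (EN i XX).2 w ->
    d i (z + w) = 0 -> (sval XX).1 z /\ (sval XX).2 w.
  case: (ENP i XX) => -[Es Ns XE XN] EN0 _ _ Ez Nw; have [_ _ _ kerE] := svalP XX.
  move=> /kerE[x [x' [Xx Xx' zwE]]].
  have zx : z - x = x' - w by apply/eqP; rewrite subr_eq addrAC eq_sym subr_eq zwE addrC.
  have zx0 : z - x = 0.
    by apply: EN0; [apply: submodB => //; apply: XE|rewrite zx; apply: submodB => //; apply: XN].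
  have -> : z = x by apply/subr0_eq.
  by have -> : w = x' by apply/esym/subr0_eq; rewrite -zx.
have nextP i XX : good i.+1 (next i XX).
  case: (ENP i XX) => -[Es Ns XE XN] EN0 ENall _; split.
  - exact: (submod_image (d i) Es).
  - exact: (submod_image (d i) Ns).
  - move=> z [x Ex <-] [y Ny yx].
    have [||Xx _] := ker_split i XX x (- y) Ex; first by rewrite -scaleN1r; apply: submodZ.
      by rewrite linearB yx subrr.
    have [_ _ _ kerE] := svalP XX; apply/kerE; exists x, 0.
    by rewrite addr0; split=> //; apply: submod0; case: (svalP XX).
  - move=> z; rewrite exS; split=> [[y <-]|[_ [_ [[x Ex <-] [y Ny <-] ->]]]].
      have [x [w [Ex Nw ->]]] := ENall y; exists (d i x), (d i w); rewrite linearD.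
      by split=> //; [exists x|exists w].
    by exists (x + y); rewrite linearD.
(* The initial splitting: the images in [J 0] of [M] and of the kernel of [r]. *)
have good0 : good 0 (fun z => exists m, e (s m) = z, fun z => exists2 x, r x = 0 & e x = z).
  split.
  - exact: (submod_im (e \o s : {linear M -> J 0})).
  - exact: (submod_image e (submod_ker r)).
  - move=> _ [m <-] [x rx] /einj xE; by rewrite -[m]rs -xE rx !linear0.
  - move=> z; rewrite ex0; split=> [[x <-]|[_ [_ [[m <-] [x rx <-] ->]]]]; last first.
      by exists (s m + x); rewrite linearD.
    exists (e (s (r x))), (e (x - s (r x))); split; first by exists (r x).
      by exists (x - s (r x)); rewrite // linearB rs subrr.
    by rewrite -linearD addrC subrK.
pose st := nat_rect (fun i => {XX | @good i XX}) (exist _ _ good0)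
  (fun i XX => exist _ _ (nextP i XX)).
pose E i := (EN i (st i)).1; pose N i := (EN i (st i)).2.
have Es i : submodule (E i) by case: (ENP i (st i)) => -[].
have XE i z : (sval (st i)).1 z -> E i z by case: (ENP i (st i)) => -[_ _ + _] _ _ _; apply.
pose I i : lmodType A := submod (Es i).
have [e' e'P] := linear_corestrict (Es 0%N) (h := e \o s : {linear M -> J 0})
  (fun m => XE 0%N _ (ex_intro _ m erefl)).
have dE i (x : I i) : E i.+1 (d i (submod_incl _ x)).
  by apply: XE; exists (submod_incl _ x) => //; apply: submod_valP.
pose d' i := sval (linear_corestrict (Es i.+1) (h := d i \o submod_incl (Es i) : {linear I i -> J i.+1}) (dE i)).
have d'P i x : submod_incl _ (d' i x) = d i (submod_incl _ x).
  exact: (svalP (linear_corestrict (Es i.+1) (h := d i \o submod_incl (Es i)) (dE i)) x).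
have retr i : retract (I i) (J i).
  have [_ EN0 ENall _] := ENP i (st i).
  have Ns : submodule (N i) by case: (ENP i (st i)) => -[].
  have /choice[p pP] z : exists x, E i x /\ N i (z - x).
    by have [x [w [Ex Nw ->]]] := ENall z; exists x; rewrite addrC addKr.
  have puniq z x : E i x -> N i (z - x) -> p z = x.
    move=> Ex Nzx; apply/subr0_eq/EN0; first by apply: submodB => //; case: (pP z).
    by have := submodB Ns Nzx (pP z).2; rewrite opprB addrC addrA subrK.
  have plin a z w : p (a *: z + w) = a *: p z + p w.
    apply: puniq; first by apply: (submodP (Es i)); [case: (pP z)|case: (pP w)].
    by rewrite opprD addrACA -scalerBr; apply: (submodP Ns); [case: (pP z)|case: (pP w)].
  have [p' p'P] := linear_corestrict (Es i) (h := make_linear plin) (fun z => (pP z).1).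
  exists (submod_incl _), p' => x; apply: (@submod_incl_inj _ _ _ (Es i)).
  rewrite p'P; apply: puniq; first exact: submod_valP.
  by rewrite subrr; apply: submod0.
have kerd' i (y : I i) : d' i y = 0 <-> (sval (st i)).1 (submod_incl _ y).
  have Xs2 : submodule (N i) by case: (ENP i (st i)) => -[].
  split=> [dy0|Xy].
    have [] // := ker_split i (st i) (submod_incl _ y) 0 (submod_valP y) (submod0 Xs2).
    by rewrite addr0 -d'P dy0 linear0.
  apply: (@submod_incl_inj _ _ _ (Es i.+1)); rewrite d'P linear0.
  have [_ X2s _ kerE] := svalP (st i); apply/kerE; exists (submod_incl _ y), 0.
  by rewrite addr0; split=> //; apply: submod0.
have ess i (Z : lmodType A) (h : Z -> I i) :
    (forall y : I i, (sval (st i)).1 (submod_incl _ y) -> exists x, h x = y) -> essential_image h.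
  move=> hX K Kc [y Ky /eqP y0]; have Ks := submod_closedP Kc.
  have [_ _ _ Eess] := ENP i (st i).
  have [|a Xay ay0] := Eess (submod_incl _ y) (submod_valP y).
    by rewrite -[0](linear0 (submod_incl (Es i))) => /submod_incl_inj.
  have [x hx] := hX (a *: y) Xay; exists x; rewrite hx; first exact: (submodZ Ks).
  by apply/eqP => ay; apply: ay0; rewrite -linearZ ay linear0.
exists I, e', d'; split; last exact: retr.
have ex0' y : (sval (st 0)).1 (submod_incl (Es 0%N) y) <-> exists x, e' x = y.
  split=> [[m my]|[m <-]]; last by exists m; rewrite e'P.
  by exists m; apply: (@submod_incl_inj _ _ _ (Es 0%N)); rewrite e'P.
have exS' i y : (sval (st i.+1)).1 (submod_incl (Es i.+1) y) <-> exists x, d' i x = y.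
  split=> [[x Ex xy]|[x <-]].
    exists (Submod (Es i) Ex); apply: (@submod_incl_inj _ _ _ (Es i.+1)); rewrite d'P; exact: xy.
  by exists (submod_incl _ x); [exact: submod_valP|rewrite d'P].
split; first split.
- by move=> i; apply: retract_injective (retr i) (injJ i).
- move=> x y /(congr1 (submod_incl (Es 0%N))); rewrite !e'P => /einj /(congr1 r).
  by rewrite !rs.
- by move=> y; rewrite kerd' ex0'.
- by move=> i y; rewrite kerd' exS'.
- by apply: ess => y /ex0'.
- by move=> i; apply: ess => y /exS'.
Qed.

Lemma minimal_resolution_iso M X (I : nat -> lmodType A) (e : {linear X -> I 0})
    (d : forall i, {linear I i -> I i.+1}) (h : {linear M -> X}) :
  injective h -> surjective h -> minimal_injective_resolution e d ->
  minimal_injective_resolution (e \o h : {linear M -> I 0}) d.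
Proof.
move=> hinj hsurj [[injI einj ex0 exS] ess0 essS]; split=> //; first split=> //.
- by move=> x y /einj /hinj.
- move=> y; rewrite ex0; split=> [[x <-]|[x <-]]; last by exists (h x).
  by have [z <-] := hsurj x; exists z.
- move=> K Kc ey; have [x ex xn0] := ess0 K Kc ey.
  by have [z zx] := hsurj x; exists z; rewrite /= zx.
Qed.
End MinimalResolutions.

(** * Comparison of the two rings *)

Lemma restr_injective_resolution (L G : pzRingType) (f : {rmorphism L -> G}) (M : lmodType G)
    (I : nat -> lmodType G) (e : {linear M -> I 0}) (d : forall i, {linear I i -> I i.+1}) :
  (forall J : lmodType G, injective_module J -> injective_module (restr f J)) ->
  injective_resolution e d ->
  @injective_resolution L (restr f M) (fun i => restr f (I i)) (restr_map f e)
    (fun i => restr_map f (d i)).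
Proof. by move=> rinj [injI einj ex0 exS]; split=> // i; apply: rinj. Qed.

Lemma fin_gen_finitely_generated (A : pzRingType) (M : lmodType A) (s : seq M) :
  (forall m, in_span s m) -> finitely_generated M.
Proof.
move=> sM; exists (size s), (fun i => s`_i) => m.
apply: (in_span_nth_min (S := fun m => exists a : 'I_(size s) -> A, m = \sum_i a i *: s`_i)) (sM m).
  split=> [|b x y [a ->] [c ->]]; first by exists (fun=> 0); rewrite big1 // => i _; rewrite scale0r.
  exists (fun i => b * a i + c i); rewrite scaler_sumr -big_split; apply: eq_bigr => i _ /=.
  by rewrite scalerDl scalerA.
move=> k; exists (fun i => (i == k)%:R); rewrite (bigD1 k) //= big1 => [|i /negbTE ->].
  by rewrite eqxx scale1r addr0.
by rewrite scale0r.
Qed.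

Section ExcellentExtension.
Variables (L G : pzRingType) (f : {rmorphism L -> G}) (n : nat) (g : 'I_n -> G).
Hypothesis nb : normalizing_basis f g.
Hypothesis finj : injective f.

(** The zero ring is allowed, and then the basis may be empty; this case is set apart wherever a
    basis index has to be picked. *)
Lemma empty_basis_trivial (M : lmodType L) : n = 0 -> forall m : M, m = 0.
Proof.
move=> n0 m; have one0 : 1 = 0 :> G.
  by have [a ->] := right_gen nb 1; apply: big1 => i; have := ltn_ord i; rewrite {2}n0.
have L0 : 1 = 0 :> L by apply: finj; rewrite rmorph0 rmorph1.
by rewrite -[m]scale1r L0 scale0r.
Qed.

Lemma retract_trivial (M X : lmodType L) : (forall m : M, m = 0) -> retract M X.
Proof. by move=> M0; exists (zero_linear _ _), (zero_linear _ _) => m; rewrite [RHS]M0. Qed.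

Lemma regular_retract : retract (left_regular L) (restr f (left_regular G)).
Proof.
have [n0|[j _]] : n = 0 \/ exists j : 'I_n, True.
- by case: (posnP n) => [->|n0]; [left|right; exists (Ordinal n0)].
- exact/retract_trivial/empty_basis_trivial.
have slin (a x y : L) : f (a * x + y) * g j = f a * (f x * g j) + f y * g j.
  by rewrite rmorphD rmorphM mulrDl mulrA.
have rlin (a : L) (x y : G) : lcoef nb (f a * x + y) j = a * lcoef nb x j + lcoef nb y j.
  exact: lcoef_linear.
exists (make_linear (X := left_regular L) (Y := restr f (left_regular G)) slin).
exists (make_linear (X := restr f (left_regular G)) (Y := left_regular L) rlin) => x /=.
by rewrite lcoef_basis eqxx.
Qed.

Lemma ind_regular : exists (s : {linear left_regular G -> ind nb (left_regular L)})
  (r : {linear ind nb (left_regular L) -> left_regular G}), cancel s r /\ cancel r s.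
Proof.
pose u := ind_unit nb (left_regular L).
have slin (a x y : left_regular G) : ((a * x + y) : G) *: (u 1 : ind nb (left_regular L)) =
   (a : G) *: ((x : G) *: (u 1 : ind nb (left_regular L))) + (y : G) *: (u 1 : ind nb (left_regular L)).
  by rewrite scalerDl scalerA.
pose s : {linear left_regular G -> ind nb (left_regular L)} := make_linear (X := left_regular G) slin.
have hlin (a x y : L) : f (a * x + y) = f a * f x + f y by rewrite rmorphD rmorphM.
pose h : {linear left_regular L -> restr f (left_regular G)} :=
  make_linear (X := left_regular L) (Y := restr f (left_regular G)) hlin.
have hu a : ind_adj nb h (u a) = f a by apply: (ind_adj_unit nb h).
exists s, (ind_adj nb h); split=> [x|v].
  apply: etrans (linearZZ (ind_adj nb h) (x : G) (u 1)) _.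
  by rewrite hu rmorph1; apply: mulr1.
apply: (ind_ext (h := s \o ind_adj nb h) (k := idfun)) => a.
transitivity (s (f a)); first by congr (s _).
by apply: etrans (esym (linearZZ u a 1)) _; congr (u _); apply: mulr1.
Qed.

Lemma restr_fin_gen (M : lmodType G) : finitely_generated M -> finitely_generated (restr f M).
Proof.
case=> q [x xgen].
apply: (@fin_gen_finitely_generated _ (restr f M) [seq g i *: x j | i <- enum 'I_n, j <- enum 'I_q]) => m.
have [b ->] := xgen m; apply: (submod_sum (in_span_submodule _)) => j _.
rewrite {1}(lcoefP nb (b j)) scaler_suml; apply: (submod_sum (in_span_submodule _)) => i _.
rewrite -scalerA; apply: (submodZ (in_span_submodule _)); apply: in_span_mem.
by apply: allpairs_f; rewrite mem_enum.
Qed.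

Lemma left_ext_fin_gen : finitely_generated (left_ext f).
Proof.
by exists n, g => x; exists (lcoef nb x); exact: (lcoefP nb x).
Qed.

Lemma ind_fin_gen (M : lmodType L) : finitely_generated M -> finitely_generated (ind nb M).
Proof.
case=> q [x xgen]; pose u := ind_unit nb M.
apply: (@fin_gen_finitely_generated _ (ind nb M) [seq (u (x k) : ind nb M) | k <- enum 'I_q]) => v.
rewrite [v]ind_decomp; apply: (submod_sum (in_span_submodule _)) => j _.
apply: (submodZ (in_span_submodule _)); have [a ->] := xgen (v j).
rewrite linear_sum; apply: (submod_sum (in_span_submodule _)) => k _.
rewrite linearZ; apply: (@submodZ _ (ind nb M) _ (in_span_submodule _)); apply: in_span_mem.
by apply: map_f; rewrite mem_enum.
Qed.

Lemma pd_le_restr m (M : lmodType G) : pd_le m M -> pd_le m (restr f M).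
Proof. by apply: restr_pd_le => P; apply: (restr_projective nb). Qed.

Lemma pd_le_ind_inv m (M : lmodType L) : pd_le m (restr f (ind nb M)) -> pd_le m M.
Proof.
move=> pdI; have [n0|[j _]] : n = 0 \/ exists j : 'I_n, True.
- by case: (posnP n) => [->|n0]; [left|right; exists (Ordinal n0)].
- exact: retract_pd_le (retract_trivial _ (empty_basis_trivial n0)) pdI.
have [s [t [st ts sP]]] := basis_automorphism nb j.
apply: retract_pd_le (ind_retract_twist nb M ts sP) _.
by apply: restr_pd_le pdI => P; apply: (restr_aut_projective st ts).
Qed.

Hypothesis relinj : relatively_injective f.

Lemma ind_injective (M : lmodType L) : injective_module M -> injective_module (ind nb M).
Proof. by move=> injM; apply/relinj/ind_restr_injective. Qed.

Lemma ind_id_le m (M : lmodType L) : id_le m M -> id_le m (ind nb M).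
Proof.
elim: m M => [|m IHm] M; first exact: ind_injective.
case=> [I [C [j [p [injI jinj ex psurj /IHm idC]]]]].
exists (ind nb I), (ind nb C), (ind_map nb j), (ind_map nb p); split=> //.
- exact: ind_injective.
- exact: ind_map_inj.
- exact: ind_map_exact.
- exact: ind_map_surj.
Qed.

Lemma id_le_regular m : id_le m (left_regular G) <-> id_le m (left_regular L).
Proof.
split=> [idG|/ind_id_le idL].
  apply: retract_id_le regular_retract _.
  by apply: restr_id_le idG => I; apply: (restr_injective nb).
by have [s [r [sr _]]] := ind_regular; apply: retract_id_le idL; exists s, r.
Qed.

Lemma inj_dim_regular : inj_dim (left_regular G) = inj_dim (left_regular L).
Proof. by rewrite !inj_dimE; congr least; apply/funext => m; apply/propext/id_le_regular. Qed.

Lemma self_injective_ext : self_injective G <-> self_injective L.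
Proof. exact: (id_le_regular 0). Qed.

(** Starting from a non-zero [y] in [K], the coordinates are moved into the image of [h] one at a
    time. Scalars from [L] act on each coordinate through an automorphism, so coordinates already
    treated stay in the image. *)
Lemma ind_essential (X Y : lmodType L) (h : {linear X -> Y}) :
  essential_image h -> essential_image (ind_map nb h).
Proof.
move=> ess K Kc [y Ky y0]; have Ks := submod_closedP Kc.
suff [v [Kv v0 vim]] : exists v : ind nb Y, [/\ v \in K, v != 0
    & forall j : 'I_n, exists x, h x = v j].
  have /choice[u uv] := vim; have uE : ind_map nb h [ffun j => u j] = v.
    by apply/ffunP => j; rewrite ind_mapE ffunE uv.
  by exists [ffun j => u j]; rewrite uE.
have /choice[s sP] j : exists s : L -> L, bijective s /\ forall a, f a * g j = g j * f (s a).
  have [s [t [st ts sP]]] := basis_automorphism nb j.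
  by exists s; split=> //; exists t.
have twist a (v : ind nb Y) j : (f a *: v) j = s j a *: v j.
  by apply: (indZE_twist (s := s)) => l b; case: (sP l) => _; apply.
suff P k : (k <= n)%N -> exists v : ind nb Y, [/\ v \in K, v != 0
    & forall j : 'I_n, (j < k)%N -> exists x, h x = v j].
  by have [v [Kv v0 vim]] := P n (leqnn n); exists v; split=> // j; apply: vim.
elim: k => [|k IHk] kn; first by exists y.
have [v [Kv v0 vim]] := IHk (ltnW kn); pose i := Ordinal kn.
have [vi0|/eqP vi0] := pselect (v i = 0).
  exists v; split=> // j; rewrite ltnS leq_eqVlt => /predU1P[jk|/vim//].
  by exists 0; rewrite linear0 -vi0; congr (v _); apply: val_inj.
have [|x /asboolW[a hx] hx0] := ess (fun z => `[< exists a, z = a *: v i >])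
    (submodule_pred (submod_cyclic (v i))).
  by exists (v i) => //; apply/asboolT; exists 1; rewrite scale1r.
have [[t st ts] _] := sP i.
(* With [t] inverse to the twist [s i], the scalar [f (t a)] acts on the [i]-th coordinate as [a];
   this coordinate stays non-zero, and therefore so does the vector. *)
exists (f (t a) *: v); split; first exact: (submodZ Ks).
  apply/eqP => /(congr1 (fun w : ind nb Y => w i)); rewrite twist ts -hx ffunE => hx0'.
  by rewrite hx0' eqxx in hx0.
move=> j; rewrite ltnS leq_eqVlt => /predU1P[jk|/vim[z zv]].
  by exists x; rewrite twist (_ : j = i) ?ts //; apply: val_inj.
by exists (s j (t a) *: z); rewrite twist linearZ zv.
Qed.

Lemma ind_minimal_resolution (M : lmodType L) (I : nat -> lmodType L) (e : {linear M -> I 0})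
    (d : forall i, {linear I i -> I i.+1}) :
  minimal_injective_resolution e d ->
  @minimal_injective_resolution G (ind nb M) (fun i => ind nb (I i)) (ind_map nb e)
    (fun i => ind_map nb (d i)).
Proof.
case=> [[injI einj ex0 exS] ess0 essS]; split; first split.
- by move=> i; apply: ind_injective.
- exact: ind_map_inj.
- exact: ind_map_exact.
- by move=> i; apply: ind_map_exact.
- exact: ind_essential.
- by move=> i; apply: ind_essential.
Qed.

Lemma regular_resolution_down (J : nat -> lmodType G) (e : {linear left_regular G -> J 0})
    (d : forall i, {linear J i -> J i.+1}) : minimal_injective_resolution e d ->
  exists (I : nat -> lmodType L) (e' : {linear left_regular L -> I 0})
         (d' : forall i, {linear I i -> I i.+1}),
    minimal_injective_resolution e' d' /\ forall i, retract (I i) (restr f (J i)).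
Proof.
case=> res _ _; apply: (minimal_resolution_retract regular_retract).
apply: (restr_injective_resolution _ res) => I; exact: (restr_injective nb).
Qed.

Lemma regular_resolution_up (I : nat -> lmodType L) (e : {linear left_regular L -> I 0})
    (d : forall i, {linear I i -> I i.+1}) : minimal_injective_resolution e d ->
  exists (e' : {linear left_regular G -> ind nb (I 0)})
         (d' : forall i, {linear ind nb (I i) -> ind nb (I i.+1)}),
    @minimal_injective_resolution G (left_regular G) (fun i => ind nb (I i)) e' d'.
Proof.
move=> /ind_minimal_resolution res; have [s [r [sr rs]]] := ind_regular.
have := minimal_resolution_iso (can_inj sr) (fun y => ex_intro _ (r y) (rs y)) res.
by move=> res'; exists (ind_map nb e \o s), (fun i => ind_map nb (d i)).
Qed.

(** [Gorenstein] also involves the right regular modules, which belong to the converse extension;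
    its invariance is therefore taken as a premise here. *)
Lemma AGC_ext : (Gorenstein L <-> Gorenstein G) -> AGC L <-> AGC G.
Proof.
move=> gor; split=> [agc J e d /regular_resolution_down[I [e' [d' [res retr]]]] pdJ|agc I e d].
  apply/gor; apply: (agc I e' d' res) => i; apply/proj_dim_le.
  by apply: retract_pd_le (retr i) _; apply/pd_le_restr/proj_dim_le.
move=> /regular_resolution_up[e' [d' res]] pdI; apply/gor; apply: (agc (fun i => ind nb (I i)) e' d' res) => i.
by apply/proj_dim_le/ind_pd_le/proj_dim_le.
Qed.

Lemma NC_ext : NC L <-> NC G.
Proof.
split=> [nc J e d /regular_resolution_down[I [e' [d' [res retr]]]] projJ|nc I e d].
  apply/self_injective_ext; apply: (nc I e' d' res) => i.
  by apply: retract_projective (retr i) _; apply: (restr_projective nb).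
move=> /regular_resolution_up[e' [d' res]] projI.
by apply/self_injective_ext; apply: (nc (fun i => ind nb (I i)) e' d' res) => i; apply: ind_projective.
Qed.

(** The same bound [b] serves both rings: a module over [G] is a retract of one induced from its
    restriction, and induction both preserves and reflects the bounds on projective dimension. *)
Lemma FDC_ext :
  (forall M : lmodType G, finitely_generated M -> retract M (ind nb (restr f M))) ->
  FDC L <-> FDC G.
Proof.
move=> retr; split=> -[b bP]; exists b => M fgM; rewrite {1}proj_dimE => /least_neq_None[m pdM].
  apply/proj_dim_le; apply: retract_pd_le (retr M fgM) _; apply/ind_pd_le/proj_dim_le.
  apply: bP; first exact: restr_fin_gen.
  by rewrite proj_dimE; apply/least_neq_None; exists m; apply: pd_le_restr.
apply/proj_dim_le/pd_le_ind_inv/pd_le_restr/proj_dim_le; apply: bP; first exact: ind_fin_gen.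
by rewrite proj_dimE; apply/least_neq_None; exists m; apply: ind_pd_le.
Qed.
End ExcellentExtension.

Theorem theorem1p1 (Lambda Gamma : pzRingType) (f : {rmorphism Lambda -> Gamma}) :
  artin_algebra Lambda -> excellent_extension f ->
  (AGC Lambda <-> AGC Gamma) /\
  (NC Lambda <-> NC Gamma) /\
  (GSC Lambda <-> GSC Gamma) /\
  (FDC Lambda <-> FDC Gamma).
Proof.
move=> artL exc; have [[finj relproj _ _ _] _] := exc.
have [n [g nb]] := excellent_normalizing_basis exc.
have nbc := normalizing_basis_conv nb.
have noeth : noetherian Gamma^o.
  exact: noetherian_ext (left_ext_fin_gen nb) (artin_algebra_noetherian artL).
have relinj := left_relatively_injective relproj noeth.
have idl := inj_dim_regular nb finj relinj.
(* The comparison is applied to the converse rings. There the splitting hypothesis is already on the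
   required side, and coinduction gives relative injectivity directly. *)
have idr : inj_dim (right_regular Gamma) = inj_dim (right_regular Lambda).
  by apply: (inj_dim_regular nbc) => //; apply: relatively_projective_injective.
split; first by apply: (AGC_ext nb finj relinj); rewrite /Gorenstein idl idr.
split; first exact: (NC_ext nb finj relinj).
split; first by rewrite /GSC idl idr.
by apply: (FDC_ext (nb := nb)) => // M fgM; apply: ind_retract.
Qed.
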